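(* Consider the problem $\min_{u\in\mathbb{R}^d} G(u)$ subject to $Bu=b$, where $B\in\mathbb{R}^{s\times d}$ is nonzero and $b$ lies in the column space of $B$. Let $G$ be convex, $L$-smooth and $\mu$-strongly convex with $0\le \mu<L$ (where $\mu=0$ means merely convex). Let $u^*$ be a solution, let $u^0$ satisfy $\|u^0-u^*\|^2\le R^2$, and let $\varepsilon>0$. Write $\kappa_B=\sigma_{\max}^2(B)/\sigma_{\min^+}^2(B)$. 1. (Strongly convex case, $\mu>0$.) There exists a choice of parameters $\eta,\theta,\alpha>0$, $\tau\in(0,1)$ for APAPC such that after $N=O\big(\kappa_B\sqrt{L/\mu}\,\log(1/\varepsilon)\big)$ iterations the output $u^N$ satisfies $\|u^N-u^*\|^2\le\varepsilon$. 2. (Convex case, $\mu=0$.) Applying APAPC (with suitable parameters) to the regularized function $G^{\nu}(u)=G(u)+\frac{\nu}{2}\|u^0-u\|^2$ with $\nu=\varepsilon/R^2$ under the same constraint $Bu=b$, after $N=O\big(\kappa_B\sqrt{LR^2/\varepsilon}\,\log(1/\varepsilon)\big)$ iterations one obtains $u^N$ with $G(u^N)-G(u^* )\le\varepsilon$ and $\|Bu^N-b\|^2\le O(\sigma_{\max}^2(B)\varepsilon^2)$.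
   Context: $\sigma_{\max}(B)$ and $\sigma_{\min^+}(B)$ denote the largest and the smallest positive singular values of $B$. $G$ is $L$-smooth if it is differentiable and $G(u')-G(u)-\langle\nabla G(u),u'-u\rangle\le\frac L2\|u'-u\|^2$ for all $u,u'$; it is $\mu$-strongly convex if $G(u')\ge G(u)+\langle\nabla G(u),u'-u\rangle+\frac\mu2\|u'-u\|^2$ for all $u,u'$. APAPC (Accelerated Proximal Alternating Predictor–Corrector) for $\min G(u)$ s.t. $Bu=b$, with input $u^0$ and parameters $\eta,\theta,\alpha>0$, $\tau\in(0,1)$, $N\in\mathbb{N}$: set $u_f^0=u^0$, $z^0=0$; for $k=0,\dots,N-1$: $u_g^k=\tau u^k+(1-\tau)u_f^k$; $u^{k+1/2}=(1+\eta\alpha)^{-1}(u^k-\eta(\nabla G(u_g^k)-\alpha u_g^k+z^k))$; $z^{k+1}=z^k+\theta B^\top(Bu^{k+1/2}-b)$; $u^{k+1}=(1+\eta\alpha)^{-1}(u^k-\eta(\nabla G(u_g^k)-\alpha u_g^k+z^{k+1}))$; $u_f^{k+1}=u_g^k+\frac{2\tau}{2-\tau}(u^{k+1}-u^k)$; output $u^N$. *)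

(* Defs.v *)
From HB Require Import structures.
From mathcomp Require Import all_boot all_order all_algebra.
From mathcomp Require Import all_classical all_reals all_analysis.
Set Implicit Arguments. Unset Strict Implicit. Unset Printing Implicit Defensive.
Import Order.TTheory GRing.Theory Num.Theory.
Import numFieldNormedType.Exports.
Local Open Scope ring_scope.

Section Defs.
Variable R : realType.

Definition dotv (n : nat) (u v : 'cV[R]_n) : R := \sum_(i < n) u i 0 * v i 0.
Definition sqnorm (n : nat) (u : 'cV[R]_n) : R := dotv u u.

Definition grad (d : nat) (G : 'cV[R]_d -> R) (u : 'cV[R]_d) : 'cV[R]_d :=
  \col_(i < d) ('d G u : 'cV[R]_d -> R) (delta_mx i 0).

Definition convex_fun (d : nat) (G : 'cV[R]_d -> R) : Prop :=
  forall (u v : 'cV[R]_d) (t : R), 0 <= t <= 1 ->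
    G (t *: u + (1 - t) *: v) <= t * G u + (1 - t) * G v.

Definition L_smooth (d : nat) (G : 'cV[R]_d -> R) (L : R) : Prop :=
  (forall u, differentiable G u) /\
  forall u u' : 'cV[R]_d,
    G u' - G u - dotv (grad G u) (u' - u) <= L / 2 * sqnorm (u' - u).

(* mu-strongly convex (first-order definition; G is assumed differentiable). *)
Definition strongly_convex (d : nat) (G : 'cV[R]_d -> R) (mu : R) : Prop :=
  forall u u' : 'cV[R]_d,
    G u + dotv (grad G u) (u' - u) + mu / 2 * sqnorm (u' - u) <= G u'.

Definition is_solution (s d : nat) (G : 'cV[R]_d -> R) (B : 'M[R]_(s, d))
  (b : 'cV[R]_s) (ustar : 'cV[R]_d) : Prop :=
  B *m ustar = b /\ forall u, B *m u = b -> G ustar <= G u.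

Definition singular_value (s d : nat) (B : 'M[R]_(s, d)) (sg : R) : Prop :=
  0 <= sg /\ eigenvalue (B^T *m B) (sg ^+ 2).

Definition sigma_max (s d : nat) (B : 'M[R]_(s, d)) : R :=
  sup [set sg | singular_value B sg].

Definition sigma_minp (s d : nat) (B : 'M[R]_(s, d)) : R :=
  inf [set sg | singular_value B sg /\ 0 < sg].

Definition kappaB (s d : nat) (B : 'M[R]_(s, d)) : R :=
  sigma_max B ^+ 2 / sigma_minp B ^+ 2.

Definition apapc_step (s d : nat) (G : 'cV[R]_d -> R) (B : 'M[R]_(s, d))
  (b : 'cV[R]_s) (eta theta alpha tau : R)
  (st : 'cV[R]_d * 'cV[R]_d * 'cV[R]_d) : 'cV[R]_d * 'cV[R]_d * 'cV[R]_d :=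
  let: (u, uf, z) := st in
  let ug := tau *: u + (1 - tau) *: uf in
  let gr := grad G ug - alpha *: ug in
  let uh := (1 + eta * alpha)^-1 *: (u - eta *: (gr + z)) in
  let z' := z + theta *: (B^T *m (B *m uh - b)) in
  let u' := (1 + eta * alpha)^-1 *: (u - eta *: (gr + z')) in
  let uf' := ug + (2 * tau / (2 - tau)) *: (u' - u) in
  (u', uf', z').

Definition apapc (s d : nat) (G : 'cV[R]_d -> R) (B : 'M[R]_(s, d))
  (b : 'cV[R]_s) (eta theta alpha tau : R) (N : nat) (u0 : 'cV[R]_d)
  : 'cV[R]_d :=
  (iter N (apapc_step G B b eta theta alpha tau) (u0, u0, 0)).1.1.

Definition regG (d : nat) (G : 'cV[R]_d -> R) (nu : R) (u0 : 'cV[R]_d)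
  (u : 'cV[R]_d) : R := G u + nu / 2 * sqnorm (u0 - u).

End Defs.

(* Main.v *)
Require Import Defs.
From HB Require Import structures.
From mathcomp Require Import all_boot all_order all_algebra.
From mathcomp Require Import all_classical all_reals all_analysis.
From mathcomp Require Import ring lra.
Import Order.TTheory GRing.Theory Num.Theory.
Import numFieldNormedType.Exports.
Local Open Scope ring_scope.

(** Write z = B^T p with p in the range of B; optimality of the solution us reads
grad G us + B^T (B ws) = 0 for some ws, because grad G us is orthogonal to the
kernel of B. With tau = sqrt (mu / L) / 2, eta = 1 / (4 tau L), alpha = mu and
theta = 1 / (eta sigma_max^2), the Lyapunov function
  (1/eta + mu) |u - us|^2 + (2 - tau)/tau D(uf, us) + |r|^2 / theta
    - eta/(1 + eta mu) |B^T r|^2 + sigma_minp^2 |r|^2 / (24 L),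
where r = p - B ws is the dual error and D is the Bregman distance of G, shrinks by
the factor 1 + tau / (6 kappaB) at each step.

In the convex case the regularised objective is L + nu smooth and nu strongly
convex, its solution stays within Rad of u0, hence gradients of G there are bounded
independently of eps, and accuracy of order eps in the iterate suffices. For eps
above an instance-dependent threshold u0 itself is good enough (N = 0); below it the
gap between sqrt (1 + L Rad^2 / eps) and sqrt (L Rad^2 / eps) goes into C0. *)

(** * Dot products *)

Section DotProduct.
Context {R : realType}.
Implicit Types (n m s d : nat) (a c t : R).

Lemma dotvC {n} (u v : 'cV[R]_n) : dotv u v = dotv v u.
Proof. by apply: eq_bigr => i _; rewrite mulrC. Qed.

Lemma dotvDl {n} (u v w : 'cV[R]_n) : dotv (u + v) w = dotv u w + dotv v w.
Proof. by rewrite -big_split; apply: eq_bigr => i _; rewrite mxE mulrDl. Qed.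

Lemma dotvZl {n} a (u w : 'cV[R]_n) : dotv (a *: u) w = a * dotv u w.
Proof. by rewrite mulr_sumr; apply: eq_bigr => i _; rewrite mxE mulrA. Qed.

Lemma dotvNl {n} (u w : 'cV[R]_n) : dotv (- u) w = - dotv u w.
Proof. by rewrite -scaleN1r dotvZl mulN1r. Qed.

Lemma dotvDr {n} (u v w : 'cV[R]_n) : dotv w (u + v) = dotv w u + dotv w v.
Proof. by rewrite !(dotvC w) dotvDl. Qed.

Lemma dotvZr {n} a (u w : 'cV[R]_n) : dotv w (a *: u) = a * dotv w u.
Proof. by rewrite !(dotvC w) dotvZl. Qed.

Lemma dotvNr {n} (u w : 'cV[R]_n) : dotv w (- u) = - dotv w u.
Proof. by rewrite !(dotvC w) dotvNl. Qed.

Lemma dot0v {n} (u : 'cV[R]_n) : dotv 0 u = 0.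
Proof. by rewrite -(scale0r 0) dotvZl mul0r. Qed.

Definition dotvE := (@dotvDl, @dotvDr, @dotvNl, @dotvNr, @dotvZl, @dotvZr).

Lemma dotv_mx {n} (u v : 'cV[R]_n) : dotv u v = (u^T *m v) 0 0.
Proof. by rewrite mxE; apply: eq_bigr => i _; rewrite mxE. Qed.

Lemma dotv_mull {s d} (B : 'M[R]_(s, d)) (u : 'cV[R]_d) (v : 'cV[R]_s) :
  dotv (B *m u) v = dotv u (B^T *m v).
Proof. by rewrite !dotv_mx trmx_mul mulmxA. Qed.

Lemma dotv_mulr {s d} (B : 'M[R]_(s, d)) (u : 'cV[R]_d) (v : 'cV[R]_s) :
  dotv v (B *m u) = dotv (B^T *m v) u.
Proof. by rewrite dotvC dotv_mull dotvC. Qed.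

Lemma sqnorm_ge0 {n} (u : 'cV[R]_n) : 0 <= sqnorm u.
Proof. by apply: sumr_ge0 => i _; rewrite -expr2 sqr_ge0. Qed.

Lemma sqnorm_eq0 {n} (u : 'cV[R]_n) : (sqnorm u == 0) = (u == 0).
Proof.
apply/eqP/eqP => [/psumr_eq0P u0|->]; last exact: dot0v.
apply/matrixP => i j; rewrite ord1 mxE; apply/eqP.
by rewrite -sqrf_eq0 expr2 u0 // => k _; rewrite -expr2 sqr_ge0.
Qed.

Lemma sqnorm_gt0 {n} (u : 'cV[R]_n) : (0 < sqnorm u) = (u != 0).
Proof. by rewrite lt_def sqnorm_ge0 sqnorm_eq0 andbT. Qed.

Lemma sqnorm0 n : sqnorm (0 : 'cV[R]_n) = 0.
Proof. exact: dot0v. Qed.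

Lemma sqnormN {n} (u : 'cV[R]_n) : sqnorm (- u) = sqnorm u.
Proof. by rewrite /sqnorm !dotvE opprK. Qed.

Lemma sqnormZ {n} a (u : 'cV[R]_n) : sqnorm (a *: u) = a ^+ 2 * sqnorm u.
Proof. by rewrite /sqnorm !dotvE; ring. Qed.

Lemma sqnormD {n} (u v : 'cV[R]_n) :
  sqnorm (u + v) = sqnorm u + 2 * dotv u v + sqnorm v.
Proof. by rewrite /sqnorm !dotvE (dotvC v u); ring. Qed.

Lemma sqnormB {n} (u v : 'cV[R]_n) :
  sqnorm (u - v) = sqnorm u - 2 * dotv u v + sqnorm v.
Proof. by rewrite sqnormD sqnormN dotvNr; ring. Qed.

Lemma sqnorm_tr {s d} (B : 'M[R]_(s, d)) (u : 'cV[R]_d) :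
  sqnorm (B *m u) = dotv (B^T *m B *m u) u.
Proof. by rewrite /sqnorm dotv_mulr mulmxA. Qed.

Lemma sqnormD_le2 {n} (u v : 'cV[R]_n) :
  sqnorm (u + v) <= 2 * sqnorm u + 2 * sqnorm v.
Proof. by have := sqnorm_ge0 (u - v); rewrite sqnormB sqnormD; lra. Qed.

Lemma sqnorm_le2B {n} (u v : 'cV[R]_n) : sqnorm v <= 2 * sqnorm u + 2 * sqnorm (v - u).
Proof. by have := sqnormD_le2 u (v - u); rewrite addrC subrK. Qed.

Lemma sqnormD3_le {n} (u v w : 'cV[R]_n) :
  sqnorm (u + v + w) <= 3 * (sqnorm u + sqnorm v + sqnorm w).
Proof.
have := sqnorm_ge0 (u - v); have := sqnorm_ge0 (u - w).
have := sqnorm_ge0 (v - w).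
by rewrite !sqnormB !sqnormD dotvDl; lra.
Qed.

Lemma young_dotv {n} (u v : 'cV[R]_n) c : 0 < c ->
  2 * dotv u v <= c * sqnorm u + c^-1 * sqnorm v.
Proof.
move=> c0; have := mulr_ge0 (ltW c0) (sqnorm_ge0 (u - c^-1 *: v)).
rewrite sqnormB sqnormZ dotvZr.
suff -> : c * (sqnorm u - 2 * (c^-1 * dotv u v) + c^-1 ^+ 2 * sqnorm v) =
  c * sqnorm u - 2 * dotv u v + c^-1 * sqnorm v by lra.
by field; rewrite gt_eqF.
Qed.

(** A first-order condition without derivatives: if [a] were nonzero, the value at
    [t = - a / (|c| + 1)] would be negative. It serves both the Rayleigh quotient and the optimality
    condition. *)
Lemma linear_coef_eq0 {a c} : (forall t, 0 <= t * a + t ^+ 2 * c) -> a = 0.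
Proof.
move=> H; apply/eqP; apply: contraT => a0.
have K : 0 < `|c| + 1 by rewrite ltr_wpDl.
have := H (- a / (`|c| + 1)); have cle := ler_norm c.
suff : - a / (`|c| + 1) * a + (- a / (`|c| + 1)) ^+ 2 * c < 0 by rewrite ltNge => /negbTE->.
have -> : - a / (`|c| + 1) * a + (- a / (`|c| + 1)) ^+ 2 * c =
  (a / (`|c| + 1)) ^+ 2 * (c - (`|c| + 1)) by field; rewrite gt_eqF.
rewrite pmulr_rlt0; first by lra.
by rewrite exprn_even_gt0 //= mulf_neq0 // invr_neq0 // gt_eqF.
Qed.

(** The columns of [cokermx B] lie in the kernel of [B], so [g^T] annihilates them, and this is the
    criterion for [g^T] to lie in the row space of [B]. *)
Lemma orthogonal_kernel_range {s d} (B : 'M[R]_(s, d)) (g : 'cV[R]_d) :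
  (forall v, B *m v = 0 -> dotv g v = 0) -> exists w, g = B^T *m w.
Proof.
move=> H; suff /submxP[D gD] : (g^T <= B)%MS.
  by exists D^T; rewrite -trmx_mul -gD trmxK.
rewrite submxE; apply/eqP/matrixP => i j; rewrite ord1 [RHS]mxE.
have -> : (g^T *m cokermx B) 0 j = dotv g (col j (cokermx B)).
  by rewrite mxE; apply: eq_bigr => k _; rewrite !mxE.
by apply: H; rewrite colE mulmxA mulmx_coker mul0mx.
Qed.

End DotProduct.

(** * Minimisation over closed bounded sets *)

Section FiniteDimensionalAnalysis.
Local Open Scope classical_set_scope.
Context {R : realType}.
Implicit Types (n s d : nat).

Lemma sum_continuous {T : topologicalType} {n} (F : 'I_n -> T -> R) :
  (forall i, continuous (F i)) -> continuous (fun x => \sum_(i < n) F i x).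
Proof.
by move=> Fc; exact: (continuous_big (@add_continuous R) (fun i _ => Fc i)).
Qed.

Lemma entry_mulmx_continuous {s d} (B : 'M[R]_(s, d)) i :
  continuous (fun u : 'cV[R]_d => (B *m u) i 0 : R).
Proof.
have -> : (fun u : 'cV[R]_d => (B *m u) i 0 : R) =
    (fun u => \sum_(j < d) B i j * u j 0) by rewrite funeqE => u; rewrite mxE.
apply: sum_continuous => j u; apply: continuousM; first exact: cst_continuous.
exact: coord_continuous.
Qed.

Lemma dotv_mulmx_continuous {d} (A : 'M[R]_d) :
  continuous (fun u : 'cV[R]_d => dotv (A *m u) u).
Proof.
apply: sum_continuous => j u; apply: continuousM; last exact: coord_continuous.
exact: entry_mulmx_continuous.
Qed.

Lemma sqnorm_continuous {d} : continuous (@sqnorm R d).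
Proof.
by apply: sum_continuous => j u; apply: continuousM; exact: coord_continuous.
Qed.

Lemma closed_mulmx_eq {s d} (B : 'M[R]_(s, d)) (b : 'cV[R]_s) :
  closed [set u : 'cV[R]_d | B *m u = b].
Proof.
rewrite (_ : [set u | _] =
  \bigcap_(i in [set: 'I_s]) ((fun u : 'cV[R]_d => (B *m u) i 0) @^-1` [set b i 0])).
  apply: closed_bigI => i _; apply: preimage_closed; last exact: closed_eq.
  by move=> u _; exact: entry_mulmx_continuous.
apply/seteqP; split => [u /= <- //|u /= H].
by apply/matrixP => i j; rewrite ord1; exact: H.
Qed.

Lemma sqr_coord_le_sqnorm {d} (u : 'cV[R]_d) i : u i 0 ^+ 2 <= sqnorm u.
Proof.
rewrite /sqnorm /dotv (bigD1 i) //= -expr2 lerDl.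
by apply: sumr_ge0 => j _; rewrite -expr2 sqr_ge0.
Qed.

Lemma trmx_col_continuous {d} : continuous (fun v : 'rV[R]_d => v^T).
Proof.
move=> v A /(nbhs_ballP v^T) [e e0 eA].
apply/nbhs_ballP; exists e => //= w [_ vw]; apply: eA; split=> // i j.
by rewrite !mxE; exact: vw.
Qed.

(** The extreme value theorem is applied to row vectors, so [f] and [A] are pulled back along
    transposition; the Euclidean bound controls each coordinate and hence the max norm. *)
Lemma min_closed_bounded {d} (f : 'cV[R]_d -> R) (A : set 'cV[R]_d) (M : R) :
  continuous f -> closed A -> (forall u, A u -> sqnorm u <= M) -> A !=set0 ->
  exists2 c, A c & forall u, A u -> f c <= f u.
Proof.
move=> fc Ac AM [u0 Au0].
pose tr (v : 'rV[R]_d) : 'cV[R]_d := v^T.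
have trc : continuous tr := trmx_col_continuous.
have [|||c] := @EVT_min_rV R d (f \o tr) (tr @^-1` A).
- by exists u0^T; rewrite /preimage /= /tr trmxK.
- apply: bounded_closed_compact; last first.
    by apply: preimage_closed => // v _; exact: trc.
  exists (1 + M); split; first exact: num_real.
  move=> x Mx v /= Av.
  have M0 : 0 <= M := le_trans (sqnorm_ge0 _) (AM _ Au0).
  rewrite [leLHS]/Num.norm /= mx_normrE; apply/bigmax_leP; split=> [|[i j] _ /=].
    by lra.
  rewrite -ler_sqr ?nnegrE // ?real_normK ?num_real //; last by lra.
  have := le_trans (sqr_coord_le_sqnorm (tr v) j) (AM _ Av).
  by rewrite ord1 mxE => /le_trans; apply; nra.
- by apply: continuous_subspaceT => v; apply: continuous_comp; [exact: trc | exact: fc].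
rewrite inE /= => Ac' H; exists (tr c) => // u Au.
by have := H u^T; rewrite /= inE /= /tr trmxK; apply.
Qed.
End FiniteDimensionalAnalysis.

(** * Extreme singular values *)

Section SingularValues.
Local Open Scope classical_set_scope.
Context {R : realType}.
Implicit Types (n s d : nat).

(* For M = 0 this is the least eigenvalue; M cuts out an A-invariant subspace, so that
the kernel of A can be avoided. *)
Lemma rayleigh_min {s d} (A : 'M[R]_d) (M : 'M[R]_(s, d)) (u0 : 'cV[R]_d) :
  A^T = A -> (forall u : 'cV[R]_d, M *m u = 0 -> M *m (A *m u) = 0) ->
  u0 != 0 -> M *m u0 = 0 ->
  exists m (w : 'cV[R]_d), [/\ w != 0, M *m w = 0, A *m w = m *: w &
    forall u : 'cV[R]_d, M *m u = 0 -> m * sqnorm u <= dotv (A *m u) u].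
Proof.
move=> AT MA u00 Mu0.
pose S := [set u : 'cV[R]_d | M *m u = 0] `&` (@sqnorm R d) @^-1` [set (1 : R)].
have normS (u : 'cV[R]_d) : u != 0 -> M *m u = 0 -> S ((Num.sqrt (sqnorm u))^-1 *: u).
  move=> uN0 Mu; split; first by rewrite /= -scalemxAr Mu scaler0.
  by rewrite /= sqnormZ exprVn sqr_sqrtr ?sqnorm_ge0 // mulVf // sqnorm_eq0.
have Sc : closed S.
  apply: closedI; first exact: closed_mulmx_eq.
  by apply: preimage_closed; [move=> u _; exact: sqnorm_continuous | exact: closed_eq].
have [||w [Mw w1] wmin] := @min_closed_bounded R d _ _ 1 (dotv_mulmx_continuous A) Sc.
- by move=> u [_ /= ->].
- by exists ((Num.sqrt (sqnorm u0))^-1 *: u0); exact: normS.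
rewrite /= in Mw w1.
set m := dotv (A *m w) w in wmin.
have quad (u : 'cV[R]_d) : M *m u = 0 -> m * sqnorm u <= dotv (A *m u) u.
  move=> Mu; have [->|uN0] := eqVneq u 0; first by rewrite mulmx0 sqnorm0 dot0v mulr0.
  have := wmin _ (normS _ uN0 Mu).
  rewrite -scalemxAr dotvZl dotvZr mulrA -expr2 exprVn sqr_sqrtr ?sqnorm_ge0 //.
  by rewrite ler_pdivlMl ?sqnorm_gt0 // mulrC.
have w0 : w != 0 by rewrite -sqnorm_eq0 w1 oner_eq0.
exists m, w; split => //.
have [h hE] : exists h, h = A *m w - m *: w by eexists.
have Mh : M *m h = 0 by rewrite hE mulmxBr MA // -scalemxAr Mw scaler0 subr0.
(* The form [dotv (A *m u) u - m * sqnorm u] is nonnegative on the kernel of [M] and vanishes at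
   [w]; its linear coefficient along the residual [h] is [2 * sqnorm h], which must therefore be
   zero. *)
have hh : 2 * sqnorm h = 0.
  apply: (@linear_coef_eq0 R _ (dotv (A *m h) h - m * sqnorm h)) => t.
  have /quad : M *m (w + t *: h) = 0 by rewrite mulmxDr -scalemxAr Mw Mh scaler0 addr0.
  have hw : sqnorm h = dotv (A *m w) h - m * dotv w h.
    by rewrite -dotvZl -dotvNl -dotvDl -hE.
  have Ahw : dotv (A *m h) w = dotv (A *m w) h by rewrite dotv_mull AT dotvC.
  rewrite mulmxDr -scalemxAr sqnormD sqnormZ !dotvE Ahw w1 -/m => H.
  by rewrite hw; rewrite hw in H; nra.
apply/subr0_eq; rewrite -hE; apply/eqP; rewrite -sqnorm_eq0; apply/eqP; lra.
Qed.

(** [eigenvalue] refers to row eigenvectors; as [B^T *m B] is symmetric, transposition gives column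
    ones. *)
Lemma singular_valueP {s d} (B : 'M[R]_(s, d)) sg :
  singular_value B sg <->
  0 <= sg /\ exists2 v : 'cV[R]_d, B^T *m B *m v = sg ^+ 2 *: v & v != 0.
Proof.
split=> -[sg0 H]; split=> //.
  have [v Hv v0] := eigenvalueP H; exists v^T; last by rewrite trmx_eq0.
  by apply: trmx_inj; rewrite !trmx_mul !trmxK linearZ /= trmxK mulmxA -mulmxA.
have [v Hv v0] := H; apply/eigenvalueP; exists v^T; last by rewrite trmx_eq0.
by apply: trmx_inj; rewrite trmx_mul trmx_mul !trmxK linearZ /= trmxK.
Qed.

Lemma singular_value_sqnorm {s d} (B : 'M[R]_(s, d)) (v : 'cV[R]_d) c :
  B^T *m B *m v = c *: v -> sqnorm (B *m v) = c * sqnorm v.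
Proof. by move=> Hv; rewrite sqnorm_tr Hv dotvZl. Qed.

(** The least eigenvalue [m] of [- (B^T *m B)], taken over the whole space through a constraint
    matrix with no rows, gives the singular value [Num.sqrt (- m)]. *)
Lemma max_singular_value {s d} (B : 'M[R]_(s, d)) : B != 0 ->
  exists2 sg, singular_value B sg & forall u, sqnorm (B *m u) <= sg ^+ 2 * sqnorm u.
Proof.
move=> B0.
have [u0 u00] : exists u0 : 'cV[R]_d, u0 != 0.
  have [i /eqP Bi] : exists i, row i B <> 0.
    by apply/existsNP => H; move/eqP: B0; apply; apply/row_matrixP => i; rewrite H row0.
  by exists (row i B)^T; rewrite trmx_eq0.
have [||||m [w [w0 _ Aw quad]]] := @rayleigh_min 0 d (- (B^T *m B)) 0 u0.
- by rewrite linearN /= trmx_mul trmxK.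
- by move=> u _; rewrite mul0mx.
- by [].
- by rewrite mul0mx.
have Bw : B^T *m B *m w = - m *: w by rewrite scaleNr -Aw mulNmx opprK.
have m0 : 0 <= - m.
  by have := sqnorm_ge0 (B *m w);
    rewrite (singular_value_sqnorm _ _ _ Bw) pmulr_lge0 ?sqnorm_gt0.
exists (Num.sqrt (- m)).
  by apply/singular_valueP; split; [exact: sqrtr_ge0 | exists w => //; rewrite sqr_sqrtr].
move=> u; have := quad u (mul0mx _ _); rewrite sqr_sqrtr // mulNmx dotvNl -sqnorm_tr.
by rewrite mulNr lerNr.
Qed.

(** The Rayleigh quotient of [B *m B^T] is minimised over the range of [B], written as the kernel of
    [M]; on that range [B^T] is injective, so the minimum is positive. If [w] is the minimiser,
    [B^T *m w] is an eigenvector of [B^T *m B] for the same eigenvalue. *)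
Lemma min_singular_value {s d} (B : 'M[R]_(s, d)) : B != 0 ->
  exists2 sg, singular_value B sg /\ 0 < sg &
    forall u, sg ^+ 2 * sqnorm (B *m u) <= sqnorm (B^T *m (B *m u)).
Proof.
move=> B0.
pose M := (cokermx B^T)^T.
have MP (u : 'cV[R]_s) : M *m u = 0 <-> exists v, u = B *m v.
  have -> : (M *m u = 0) <-> (u^T <= B^T)%MS.
    rewrite submxE -{1}[u]trmxK -trmx_mul; split=> [H|/eqP->]; last exact: trmx0.
    by apply/eqP/trmx_inj; rewrite H trmx0.
  split=> [/submxP [D uD]|[v ->]]; last by rewrite trmx_mul submxMl.
  by exists D^T; apply: trmx_inj; rewrite trmx_mul trmxK.
have [u0 u00] : exists u0 : 'cV[R]_d, B *m u0 != 0.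
  have [i /eqP Bi] : exists i, col i B <> 0.
    by apply/existsNP => H; move/eqP: B0; apply; apply/matrixP => i j;
      have /matrixP/(_ i 0) := H j; rewrite !mxE.
  by exists (delta_mx i 0); rewrite -colE.
have [||||m [w [w0 Mw Aw quad]]] := @rayleigh_min _ s (B *m B^T) M (B *m u0).
- by rewrite trmx_mul trmxK.
- by move=> u _; apply/MP; exists (B^T *m u); rewrite mulmxA.
- by [].
- by apply/MP; exists u0.
have [x wx] := (MP w).1 Mw.
have Bw : sqnorm (B^T *m w) = m * sqnorm w by rewrite sqnorm_tr trmxK Aw dotvZl.
have Bw0 : B^T *m w != 0.
  apply: contra_neq w0; rewrite wx mulmxA => Wx; apply/eqP.
  by rewrite -sqnorm_eq0 sqnorm_tr Wx dot0v.
have m0 : 0 < m by move: Bw0; rewrite -sqnorm_gt0 Bw pmulr_lgt0 ?sqnorm_gt0.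
exists (Num.sqrt m).
  split; last by rewrite sqrtr_gt0.
  apply/singular_valueP; split; first exact: sqrtr_ge0.
  exists (B^T *m w) => //; rewrite sqr_sqrtr ?(ltW m0) //.
  by rewrite scalemxAr -Aw !mulmxA.
move=> u; rewrite sqr_sqrtr ?(ltW m0) // (sqnorm_tr B^T) trmxK.
by apply: quad; apply/MP; exists u.
Qed.

Lemma sigma_max_ge {s d} (B : 'M[R]_(s, d)) sg : B != 0 ->
  singular_value B sg -> sg <= sigma_max B.
Proof.
move=> B0 Bsg; have [m [m0 _] mub] := max_singular_value B B0.
apply: ub_le_sup => //; exists m => x /singular_valueP [x0 [v Hv v0]].
have := mub v; rewrite (singular_value_sqnorm _ _ _ Hv) ler_pM2r ?sqnorm_gt0 //.
by rewrite ler_sqr.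
Qed.

Lemma sqnorm_le_sigma_max {s d} (B : 'M[R]_(s, d)) u : B != 0 ->
  sqnorm (B *m u) <= sigma_max B ^+ 2 * sqnorm u.
Proof.
move=> B0; have [m Bm mub] := max_singular_value B B0.
apply: le_trans (mub u) _; rewrite ler_wpM2r ?sqnorm_ge0 //.
have m0 := Bm.1; have := sigma_max_ge B m B0 Bm.
by move=> H; rewrite ler_sqr ?nnegrE // (le_trans m0).
Qed.

(** The value from [min_singular_value] bounds all positive singular values below and is one of
    them, so the infimum is attained. The last clause is the source of the dual contraction: [B^T]
    is bounded below on the range of [B]. *)
Lemma sigma_minpP {s d} (B : 'M[R]_(s, d)) : B != 0 ->
  [/\ 0 < sigma_minp B, sigma_minp B <= sigma_max B &
   forall u, sigma_minp B ^+ 2 * sqnorm (B *m u) <= sqnorm (B^T *m (B *m u))].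
Proof.
move=> B0; have [m [Bm m0] mlb] := min_singular_value B B0.
have lb sg : singular_value B sg /\ 0 < sg -> m <= sg.
  move=> [/singular_valueP [_ [v Hv v0]] sg0].
  have := mlb v; rewrite mulmxA Hv (singular_value_sqnorm _ _ _ Hv) sqnormZ mulrA.
  rewrite ler_pM2r ?sqnorm_gt0 // [leRHS]expr2 ler_pM2r ?exprn_gt0 //.
  by rewrite ler_sqr // nnegrE ltW.
have -> : sigma_minp B = m.
  apply/eqP; rewrite eq_le; apply/andP; split.
    by apply: ge_inf => //; exists m => x /lb.
  by apply: lb_le_inf; [exists m | move=> x /lb].
by split=> //; exact: sigma_max_ge.
Qed.

End SingularValues.

(** * One step of APAPC *)

Section Step.
Context {R : realType}.
Implicit Types (s d : nat).

(* Young's inequality for |B^T r|^2 = <r, B B^T r>. *)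
Lemma sqnorm_trmx_le {s d} (B : 'M[R]_(s, d)) (S : R) : 0 < S ->
  (forall u, sqnorm (B *m u) <= S * sqnorm u) ->
  forall r, sqnorm (B^T *m r) <= S * sqnorm r.
Proof.
move=> S0 BS r.
have := young_dotv (B *m (B^T *m r)) r S^-1 _; rewrite invr_gt0 invrK => /(_ S0).
rewrite dotv_mull -/(sqnorm _).
have : S^-1 * sqnorm (B *m (B^T *m r)) <= sqnorm (B^T *m r) by rewrite ler_pdivrMl.
lra.
Qed.

(** [B *m h] is the dual increment divided by [theta], and [x'] differs from [h] by the corrector
    shift. Polarising both inner products leaves the form [theta^-1 |p|^2 - c |B^T p|^2] at
    [p = q' - q], which is nonnegative because [c * theta * S <= 1]. *)
Lemma dual_step {s d} (B : 'M[R]_(s, d)) (S theta c : R)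
    (q q' : 'cV[R]_s) (h x' : 'cV[R]_d) :
  (forall r, sqnorm (B^T *m r) <= S * sqnorm r) ->
  0 < theta -> 0 <= c -> c * theta * S <= 1 ->
  q' = q + theta *: (B *m h) -> h = x' + c *: (B^T *m q' - B^T *m q) ->
  - 2 * dotv (B^T *m q') x' <=
    (theta^-1 * sqnorm q - c * sqnorm (B^T *m q)) -
    (theta^-1 * sqnorm q' - c * sqnorm (B^T *m q')).
Proof.
move=> BS th0 c0 cS q'E hE.
have Bh : dotv (B^T *m q') h = theta^-1 * (sqnorm q' - dotv q' q).
  have -> : dotv (B^T *m q') h = theta^-1 * dotv q' (theta *: (B *m h)).
    by rewrite dotvZr mulKf ?gt_eqF // dotv_mulr.
  have -> : theta *: (B *m h) = q' - q by rewrite q'E addrC addKr.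
  by rewrite /sqnorm !dotvE.
have x'E : dotv (B^T *m q') x' = theta^-1 * (sqnorm q' - dotv q' q) -
    c * (sqnorm (B^T *m q') - dotv (B^T *m q') (B^T *m q)).
  by rewrite -Bh hE /sqnorm !dotvE; ring.
have : c * sqnorm (B^T *m (q' - q)) <= theta^-1 * sqnorm (q' - q).
  apply: le_trans (ler_wpM2l c0 (BS _)) _.
  rewrite mulrA ler_wpM2r ?sqnorm_ge0 // -[leRHS]mul1r ler_pdivlMr //.
  by rewrite mulrAC.
rewrite x'E mulmxBr !sqnormB; lra.
Qed.

(* All vectors are differences from the solution. The term in sqnorm zet, which makes
the dual error contract, is paid for by the three squares in
zet = - (x' - x) / eta - gam + mu (g - x'). *)
Lemma primal_step {d} (L mu tau eta D D' Dg : R)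
    (x x' y y' g gam zet : 'cV[R]_d) :
  0 < L -> 0 < mu <= L -> 0 < tau < 1 -> eta = (4 * tau * L)^-1 ->
  g = tau *: x + (1 - tau) *: y ->
  y' = g + (2 * tau / (2 - tau)) *: (x' - x) ->
  x' = x - eta *: (gam - mu *: g + mu *: x' + zet) ->
  D' - Dg - dotv gam (y' - g) <= L / 2 * sqnorm (y' - g) ->
  Dg + dotv gam (y - g) <= D ->
  Dg - dotv gam g + mu / 2 * sqnorm g <= 0 ->
  sqnorm gam <= 2 * L * Dg ->
  (eta^-1 + mu) * sqnorm x' + (2 - tau) / tau * D' + 2 * dotv zet x' +
    (24 * L)^-1 * sqnorm zet <=
  eta^-1 * sqnorm x + 2 * (1 - tau) / tau * D.
Proof.
move=> L0 /andP[mu0 muL] /andP[t0 t1] -> gE y'E x'E H1 H2 H3 H4.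
rewrite invrK.
have k0 : 0 < 4 * tau * L by rewrite !mulr_gt0.
set k := 4 * tau * L in k0 x'E *.
pose A := (2 - tau) / tau; pose E := 2 * (1 - tau) / tau.
have AE : A = E + 1 by rewrite /A /E; field; rewrite gt_eqF.
have E0 : 0 <= E by rewrite /E divr_ge0 ?ltW //; lra.
have kw : k *: (x' - x) = - (gam - mu *: g + mu *: x' + zet).
  by rewrite [X in X - x]x'E addrC addKr scalerN scalerA mulfV ?gt_eqF // scale1r.
have [w wdef] : exists w, w = x' - x by eexists.
rewrite -wdef in y'E kw.
have xE : x = g - (E / 2) *: (y - g).
  by rewrite gE /E; apply/matrixP => i j; rewrite !mxE; field; rewrite gt_eqF.
have wE : w = (A / 2) *: (y' - g).
  rewrite y'E addrC addKr scalerA.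
  have -> : A / 2 * (2 * tau / (2 - tau)) = 1 by rewrite /A; field; rewrite !gt_eqF //; lra.
  by rewrite scale1r.
(* With [k = 4 * tau * L] the two coefficients differ exactly by the factor [2 - tau], which exceeds
   1. *)
have w2 : A * (L / 2 * sqnorm (y' - g)) <= k / 2 * sqnorm w.
  rewrite wE sqnormZ [leLHS]mulrA [leRHS]mulrA; apply: ler_wpM2r; first exact: sqnorm_ge0.
  have -> : k / 2 * (A / 2) ^+ 2 = A * (L / 2) * (2 - tau).
    by rewrite /k /A; field; rewrite gt_eqF.
  by rewrite -[leLHS]mulr1; apply: ler_wpM2l; [apply: mulr_ge0|]; lra.
have K1 : A * (D' - Dg - dotv gam (y' - g)) <= k / 2 * sqnorm w.
  by apply: le_trans w2; apply: ler_wpM2l => //; lra.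
have K2 : E * (Dg + dotv gam (y - g)) <= E * D by apply: ler_wpM2l.
(* Writing [x' = w + x], with [w] a multiple of [y' - g] and [x] a combination of [g] and [y - g],
   produces exactly the linear terms of [H1], [H2] and [H3]. *)
have gx : 2 * dotv gam x' =
    A * dotv gam (y' - g) + 2 * dotv gam g - E * dotv gam (y - g).
  have -> : x' = w + x by rewrite wdef subrK.
  have gw : dotv gam w = A / 2 * dotv gam (y' - g) by rewrite wE dotvZr.
  have gx : dotv gam x = dotv gam g - E / 2 * dotv gam (y - g).
    by rewrite xE dotvDr dotvNr dotvZr.
  by rewrite dotvDr gw gx; field.
have ww : k * (sqnorm x' - sqnorm x + sqnorm w) = 2 * dotv (k *: w) x'.
  by rewrite wdef sqnormB dotvZl dotvDl dotvNl (dotvC x') -/(sqnorm x'); ring.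
have gx' : 2 * dotv (g - x') x' = sqnorm g - sqnorm x' - sqnorm (g - x').
  by rewrite sqnormB dotvDl dotvNl -/(sqnorm x'); ring.
have kwx : dotv (k *: w) x' = - dotv gam x' + mu * dotv (g - x') x' - dotv zet x'.
  by rewrite kw !dotvE; ring.
have zE : zet = - (k *: w) - gam + mu *: (g - x').
  by rewrite kw; apply/matrixP => i j; rewrite !mxE; ring.
have Z : sqnorm zet <= 3 * (k ^+ 2 * sqnorm w + sqnorm gam + mu ^+ 2 * sqnorm (g - x')).
  rewrite [in leLHS]zE; apply: le_trans (sqnormD3_le _ _ _) _.
  by rewrite !sqnormN !sqnormZ.
have Lb0 : 0 < (24 * L)^-1 by rewrite invr_gt0 mulr_gt0.
have Lb1 : (24 * L)^-1 * L = 24^-1 by field; rewrite gt_eqF.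
have Z' := ler_wpM2l (ltW Lb0) Z.
set bet := (24 * L)^-1 in Lb0 Lb1 Z' *.
(* The three squares in [Z'] are charged to separate reserves: the half of [k * sqnorm w] not spent
   on [K1], the copy of [Dg] left over since [A = E + 1] and [H3] is used twice, and the square
   produced by [gx']. *)
have Z1 : bet * (3 * (k ^+ 2 * sqnorm w)) <= k / 2 * sqnorm w.
  have -> : bet * (3 * (k ^+ 2 * sqnorm w)) =
    k / 2 * (24 * (bet * L) * tau) * sqnorm w by rewrite /k; field.
  rewrite Lb1 ler_wpM2r ?sqnorm_ge0 // -[leRHS]mulr1 ler_wpM2l //; first by lra.
  by lra.
have Z2 : bet * (3 * sqnorm gam) <= Dg.
  have : bet * (3 * sqnorm gam) <= bet * (3 * (2 * L * Dg)).
    by rewrite ler_pM2l //; lra.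
  have -> : bet * (3 * (2 * L * Dg)) = 6 * (bet * L) * Dg by ring.
  have : 0 <= Dg by have := sqnorm_ge0 gam; nra.
  by rewrite Lb1; lra.
have Z3 : bet * (3 * (mu ^+ 2 * sqnorm (g - x'))) <= mu * sqnorm (g - x').
  have -> : bet * (3 * (mu ^+ 2 * sqnorm (g - x'))) =
    3 * (bet * mu) * (mu * sqnorm (g - x')) by ring.
  have : bet * mu <= 24^-1 by rewrite -Lb1 ler_pM2l.
  have : 0 <= mu * sqnorm (g - x') by rewrite mulr_ge0 ?sqnorm_ge0 ?ltW.
  by nra.
move: ww K1 K2 H3 Z1 Z2 Z3 Z'.
rewrite kwx -/A -/E.
have -> : 2 * (- dotv gam x' + mu * dotv (g - x') x' - dotv zet x') =
  - (2 * dotv gam x') + mu * (2 * dotv (g - x') x') - 2 * dotv zet x' by ring.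
rewrite gx gx' AE.
lra.
Qed.

End Step.

(** * Bregman distances and cocoercivity of the gradient *)

Section Bregman.
Context {R : realType} {d : nat} (G : 'cV[R]_d -> R) (L mu : R).
Context (L0 : 0 < L) (mu_ge0 : 0 <= mu).
Context (Gsmooth : L_smooth G L) (Gconv : strongly_convex G mu).

Definition bregman (u v : 'cV[R]_d) : R := G u - G v - dotv (grad G v) (u - v).

Lemma bregman_ge0 u v : 0 <= bregman u v.
Proof.
have := Gconv v u; rewrite /bregman.
by have := mulr_ge0 mu_ge0 (sqnorm_ge0 (u - v)); lra.
Qed.

Lemma bregman_le u v : bregman u v <= L / 2 * sqnorm (u - v).
Proof. exact: Gsmooth.2. Qed.

(** The three-point identity. *)
Lemma bregman3 u v w :
  bregman u w - bregman v w - dotv (grad G v - grad G w) (u - v) = bregman u v.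
Proof. by rewrite /bregman; move: (grad G v) (grad G w) => p q; rewrite !dotvE; ring. Qed.

(** The function [bregman G ^~ v] is nonnegative, and the gradient step [u - L^-1 *: dl] decreases
    it by at least [L^-1 * sqnorm dl / 2], so its value at [u] is at least that large. *)
Lemma grad_cocoercive u v : sqnorm (grad G u - grad G v) <= 2 * L * bregman u v.
Proof.
have [dl dlE] : exists dl, dl = grad G u - grad G v by eexists.
rewrite -dlE.
have H1 := bregman_le (u - L^-1 *: dl) u; have H2 := bregman_ge0 (u - L^-1 *: dl) v.
have H3 := bregman3 (u - L^-1 *: dl) u v.
have H4 : u - L^-1 *: dl - u = - (L^-1 *: dl) by rewrite addrC addKr.
rewrite -dlE H4 dotvNr dotvZr -/(sqnorm dl) in H3.
rewrite H4 sqnormN sqnormZ in H1.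
have E : L / 2 * (L^-1 ^+ 2 * sqnorm dl) = L^-1 * sqnorm dl / 2.
  by field; rewrite gt_eqF.
have : L^-1 * sqnorm dl <= 2 * bregman u v by lra.
by rewrite ler_pdivrMl //; lra.
Qed.

Lemma grad_lipschitz u v :
  sqnorm (grad G u - grad G v) <= L ^+ 2 * sqnorm (u - v).
Proof.
apply: le_trans (grad_cocoercive u v) _.
have -> : L ^+ 2 * sqnorm (u - v) = 2 * L * (L / 2 * sqnorm (u - v)) by field.
by rewrite ler_pM2l ?mulr_gt0 ?bregman_le.
Qed.

End Bregman.

(** * Linear convergence *)

Section Rate.
Context {R : realType} {s d : nat} (B : 'M[R]_(s, d)) (b : 'cV[R]_s).
Context (G : 'cV[R]_d -> R) (L mu : R) (us ws : 'cV[R]_d).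
Context (B0 : B != 0) (L0 : 0 < L) (mu0 : 0 < mu) (muL : mu <= L).
Context (Gsmooth : L_smooth G L) (Gconv : strongly_convex G mu).
Context (feas : B *m us = b) (kkt : grad G us + B^T *m (B *m ws) = 0).

Let D_ge0 u v : 0 <= bregman G u v. Proof. exact: (bregman_ge0 G mu (ltW mu0)). Qed.

Let D_le u v : bregman G u v <= L / 2 * sqnorm (u - v). Proof. exact: bregman_le. Qed.

Context (tau eta theta rho : R) (tau_gt0 : 0 < tau) (tau_sqr : tau ^+ 2 = mu / (4 * L)).
Context (etaE : eta = (4 * tau * L)^-1) (thetaE : theta = (eta * sigma_max B ^+ 2)^-1).
Context (rhoE : rho = tau / (6 * kappaB B)).

(** The dual variable is represented by [v] with [z = B^T *m (B *m v)], so that [r] lies in the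
    range of [B] by construction and the bound of [sigma_minpP] applies to it. *)
Definition lyapunov (u uf v : 'cV[R]_d) : R :=
  let r := B *m (v - ws) in
  (eta^-1 + mu) * sqnorm (u - us) + (2 - tau) / tau * bregman G uf us +
  (theta^-1 * sqnorm r - eta / (1 + eta * mu) * sqnorm (B^T *m r)) +
  (24 * L)^-1 * sigma_minp B ^+ 2 * sqnorm r.

Let tau_le : tau <= 2^-1.
Proof.
have : tau ^+ 2 <= 4^-1 by rewrite tau_sqr ler_pdivrMr ?mulr_gt0 // mulKf.
by rewrite expr2 => ?; nra.
Qed.

Let eta_gt0 : 0 < eta. Proof. by rewrite etaE invr_gt0 !mulr_gt0. Qed.

Let etamu : eta * mu = tau.
Proof.
rewrite etaE; apply/(mulfI (lt0r_neq0 tau_gt0)).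
rewrite -[RHS]expr2 tau_sqr; field; rewrite !gt_eqF //.
Qed.

Let smin_gt0 : 0 < sigma_minp B. Proof. by have [] := sigma_minpP B B0. Qed.

Let smax_gt0 : 0 < sigma_max B.
Proof. by have [h1 h2 _] := sigma_minpP B B0; exact: lt_le_trans h2. Qed.

Let smax2_gt0 : 0 < sigma_max B ^+ 2. Proof. exact: exprn_gt0. Qed.

Lemma kappaB_ge1 : 1 <= kappaB B.
Proof.
rewrite /kappaB ler_pdivlMr ?exprn_gt0 // mul1r.
rewrite ler_sqr ?nnegrE ?(ltW smin_gt0) ?(ltW smax_gt0) //.
by have [] := sigma_minpP B B0.
Qed.

Let theta_gt0 : 0 < theta.
Proof. by rewrite thetaE invr_gt0 mulr_gt0 ?exprn_gt0. Qed.

Let kappa_gt0 : 0 < kappaB B. Proof. exact: lt_le_trans ltr01 kappaB_ge1. Qed.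

Let rho_gt0 : 0 < rho. Proof. by rewrite rhoE divr_gt0 // mulr_gt0. Qed.

(** This identity calibrates [rho]: the extra dual term of [lyapunov] is exactly what raises the
    weight [theta^-1] of [sqnorm r] to [(1 + rho) * theta^-1]. *)
Let rho_theta : rho * theta^-1 = (24 * L)^-1 * sigma_minp B ^+ 2.
Proof. by rewrite rhoE thetaE etaE /kappaB; field; rewrite !gt_eqF. Qed.

Let rho_le : rho <= tau / 6.
Proof.
have k1 := kappaB_ge1; have k6 : 0 < 6 * kappaB B by rewrite mulr_gt0.
by rewrite rhoE ler_pM2l // lef_pV2 ?posrE //; lra.
Qed.

Let etamu1_gt0 : 0 < 1 + eta * mu. Proof. by rewrite etamu addr_gt0. Qed.

Let dual_coef_ge0 : 0 <= eta / (1 + eta * mu).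
Proof. by apply/ltW; exact: divr_gt0. Qed.

Let range_coef_ge0 : 0 <= (24 * L)^-1 * sigma_minp B ^+ 2.
Proof. by rewrite mulr_ge0 ?sqr_ge0 // invr_ge0; apply/ltW; rewrite mulr_gt0. Qed.

Let gradE : grad G us = - (B^T *m (B *m ws)).
Proof. by apply/eqP; rewrite -addr_eq0 kkt. Qed.

(** Adding [primal_step] and [dual_step] cancels the coupling between [r] and [u' - us]. The form of
    [z] is preserved because [b = B *m us] turns the correction into
    [theta *: B^T *m (B *m (uh - us))]. *)
Lemma apapc_step_contraction (u uf v : 'cV[R]_d) : exists u' uf' v',
  apapc_step G B b eta theta mu tau (u, uf, B^T *m (B *m v)) =
    (u', uf', B^T *m (B *m v')) /\
  (1 + rho) * lyapunov u' uf' v' <= lyapunov u uf v.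
Proof.
have [ug ugE] : exists x : 'cV[R]_d, x = tau *: u + (1 - tau) *: uf by eexists.
have [gr grE] : exists x : 'cV[R]_d, x = grad G ug - mu *: ug by eexists.
have [uh uhE] : exists x : 'cV[R]_d,
  x = (1 + eta * mu)^-1 *: (u - eta *: (gr + B^T *m (B *m v))) by eexists.
have [v' v'E] : exists x : 'cV[R]_d, x = v + theta *: (uh - us) by eexists.
have [u' u'E] : exists x : 'cV[R]_d,
  x = (1 + eta * mu)^-1 *: (u - eta *: (gr + B^T *m (B *m v'))) by eexists.
have [uf' uf'E] : exists x : 'cV[R]_d,
  x = ug + (2 * tau / (2 - tau)) *: (u' - u) by eexists.
exists u', uf', v'; split.
  rewrite /apapc_step -ugE -grE -uhE.
  have -> : B^T *m (B *m v) + theta *: (B^T *m (B *m uh - b)) = B^T *m (B *m v').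
    by rewrite v'E -feas -mulmxBr !mulmxDr -!scalemxAr !mulmxDr.
  by rewrite -u'E -uf'E.
have em0 : 1 + eta * mu != 0 by rewrite gt_eqF.
have sub2 (x y : 'cV[R]_d) : (x - us) - (y - us) = x - y by rewrite opprB addrA subrK.
have kktE (w : 'cV[R]_d) : B^T *m (B *m (w - ws)) = B^T *m (B *m w) + grad G us.
  by rewrite !mulmxBr gradE.
have P := @primal_step R d L mu tau eta
  (bregman G uf us) (bregman G uf' us) (bregman G ug us)
  (u - us) (u' - us) (uf - us) (uf' - us) (ug - us) (grad G ug - grad G us)
  (B^T *m (B *m (v' - ws))).
have Du := @dual_step R s d B (sigma_max B ^+ 2) theta (eta / (1 + eta * mu))
  (B *m (v - ws)) (B *m (v' - ws)) (uh - us) (u' - us).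
have {}Du := Du (sqnorm_trmx_le B _ smax2_gt0
  (fun u => sqnorm_le_sigma_max B u B0)) theta_gt0.
have {}P : (eta^-1 + mu) * sqnorm (u' - us) + (2 - tau) / tau * bregman G uf' us +
    2 * dotv (B^T *m (B *m (v' - ws))) (u' - us) +
    (24 * L)^-1 * sqnorm (B^T *m (B *m (v' - ws))) <=
    eta^-1 * sqnorm (u - us) + 2 * (1 - tau) / tau * bregman G uf us.
  apply: P => //.
  - by rewrite mu0.
  - by rewrite tau_gt0 /=; have := tau_le; lra.
  - by rewrite ugE; apply/matrixP => i j; rewrite !mxE; ring.
  - by rewrite sub2 uf'E addrAC.
  - rewrite kktE.
    have : (1 + eta * mu) *: u' = u - eta *: (gr + B^T *m (B *m v')).
      by rewrite u'E scalerA mulfV // scale1r.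
    rewrite grE; move: (grad G ug) (B^T *m (B *m v')) (grad G us) => gg z' gs /matrixP H.
    by apply/matrixP => i j; have := H i j; rewrite !mxE; lra.
  - by rewrite sub2 bregman3 D_le.
  - rewrite sub2; have := bregman3 G uf ug us; have := D_ge0 uf ug; lra.
  - have := Gconv ug us; rewrite /bregman -(opprB ug us) sqnormN.
    by move: (grad G ug) (grad G us) => p q; rewrite !dotvE; lra.
  - exact: (grad_cocoercive G L mu L0 (ltW mu0) Gsmooth Gconv).
have {}Du : - 2 * dotv (B^T *m (B *m (v' - ws))) (u' - us) <=
    theta^-1 * sqnorm (B *m (v - ws)) -
      eta / (1 + eta * mu) * sqnorm (B^T *m (B *m (v - ws))) -
    (theta^-1 * sqnorm (B *m (v' - ws)) -
      eta / (1 + eta * mu) * sqnorm (B^T *m (B *m (v' - ws)))).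
  apply: Du.
  - exact: dual_coef_ge0.
  - have -> : eta / (1 + eta * mu) * theta * sigma_max B ^+ 2 = (1 + eta * mu)^-1.
      by rewrite thetaE; field; rewrite em0 !gt_eqF.
    by rewrite invf_le1 ?etamu1_gt0 // etamu lerDl (ltW tau_gt0).
  - by rewrite v'E addrAC [B *m (_ + _)]mulmxDr -scalemxAr.
  - rewrite !kktE uhE u'E.
    move: (B^T *m (B *m v')) (B^T *m (B *m v)) (grad G us) => z' z gs.
    by apply/matrixP => i j; rewrite !mxE; field.
(* Since the dual error lies in the range of [B], the gain in [sqnorm (B^T *m r)] from [primal_step]
   dominates the extra [sigma_minp] term at the new iterate. *)
have [_ _ minB] := sigma_minpP B B0.
have {}minB := minB (v' - ws).
have Lb : 0 < (24 * L)^-1 by rewrite invr_gt0 mulr_gt0.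
have M1 := ler_wpM2l (ltW Lb) minB.
have X0 := sqnorm_ge0 (u - us); have D0 := D_ge0 uf us.
have r0 := sqnorm_ge0 (B *m (v - ws)).
have Br0 := sqnorm_ge0 (B^T *m (B *m (v - ws))).
set r := sqnorm (B *m (v - ws)) in Du r0.
set Br := sqnorm (B^T *m (B *m (v - ws))) in Du Br0.
set Q := theta^-1 * r - eta / (1 + eta * mu) * Br in Du.
(* Each term has its own slack for the factor [1 + rho]: [1 + tau] for the distance, [2 - tau]
   against [2 * (1 - tau)] for the Bregman term, and the extra range term for [Q]. *)
have X1 : (1 + rho) * (eta^-1 * sqnorm (u - us)) <= (eta^-1 + mu) * sqnorm (u - us).
  rewrite mulrA ler_wpM2r //.
  have -> : eta^-1 + mu = (1 + tau) * eta^-1 by rewrite -etamu; field; rewrite gt_eqF.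
  by rewrite ler_wpM2r ?invr_ge0 ?(ltW eta_gt0) //; have := rho_le; have := tau_gt0; lra.
have D1 : (1 + rho) * (2 * (1 - tau) / tau * bregman G uf us) <=
    (2 - tau) / tau * bregman G uf us.
  rewrite mulrA ler_wpM2r // mulrA ler_wpM2r ?invr_ge0 ?(ltW tau_gt0) //.
  have := rho_le; have := rho_gt0; have := tau_gt0; have := tau_le; nra.
have Q1 : (1 + rho) * Q <= Q + (24 * L)^-1 * sigma_minp B ^+ 2 * r.
  rewrite mulrDl mul1r lerD2l -rho_theta -mulrA ler_pM2l // /Q gerBl.
  exact: mulr_ge0.
have rho1 : 0 < 1 + rho by have := rho_gt0; lra.
rewrite /lyapunov -/r -/Br -/Q.
apply: le_trans (_ : (1 + rho) * (eta^-1 * sqnorm (u - us) +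
  2 * (1 - tau) / tau * bregman G uf us + Q) <= _); last by lra.
by rewrite ler_pM2l //; lra.
Qed.

Lemma apapc_lyapunov N (u0 : 'cV[R]_d) :
  exists u' uf' v', iter N (apapc_step G B b eta theta mu tau) (u0, u0, 0) =
    (u', uf', B^T *m (B *m v')) /\
  (1 + rho) ^+ N * lyapunov u' uf' v' <= lyapunov u0 u0 0.
Proof.
elim: N => [|N [u [uf [v [E H]]]]].
  by exists u0, u0, 0; rewrite !mulmx0 expr0 mul1r.
have [u' [uf' [v' [E' H']]]] := apapc_step_contraction u uf v.
exists u', uf', v'; split; first by rewrite iterS E E'.
apply: le_trans H; rewrite exprSr -mulrA ler_wpM2l // exprn_ge0 //.
by have := rho_gt0; lra.
Qed.

(** The choice of [theta] makes the subtracted term harmless: [eta * sqnorm (B^T *m r)] is at most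
    [eta * sigma_max B ^+ 2 * sqnorm r], that is [theta^-1 * sqnorm r]. *)
Lemma lyapunov_ge u uf v : eta^-1 * sqnorm (u - us) <= lyapunov u uf v.
Proof.
rewrite /lyapunov; set r := B *m (v - ws).
have H1 : 0 <= (2 - tau) / tau * bregman G uf us.
  apply: mulr_ge0 (D_ge0 _ _); apply: divr_ge0; last exact: ltW.
  by have := tau_le; lra.
have H2 : 0 <= (24 * L)^-1 * sigma_minp B ^+ 2 * sqnorm r.
  by rewrite mulr_ge0 ?sqnorm_ge0.
have H3 : eta / (1 + eta * mu) * sqnorm (B^T *m r) <= theta^-1 * sqnorm r.
  rewrite thetaE invrK -mulrA -mulrA ler_pM2l //.
  rewrite ler_pdivrMl //.
  apply: le_trans (sqnorm_trmx_le B _ smax2_gt0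
    (fun u => sqnorm_le_sigma_max B u B0) r) _.
  by rewrite ler_peMl ?(mulr_ge0 (sqr_ge0 _) (sqnorm_ge0 _)) // etamu lerDl (ltW tau_gt0).
have := sqnorm_ge0 (u - us); have := mu0; nra.
Qed.

(** At the start [r = - B *m ws] and [B^T *m r] is [grad G us], so the lower bound on the range of
    [B] replaces the multiplier by the gradient at the solution. *)
Lemma lyapunov_init u0 : eta * lyapunov u0 u0 0 <=
  3 * (L / mu) * sqnorm (u0 - us) + kappaB B / (mu * L) * sqnorm (grad G us).
Proof.
rewrite /lyapunov sub0r !mulmxN !sqnormN.
have -> : sqnorm (grad G us) = sqnorm (B^T *m (B *m ws)).
  by rewrite gradE sqnormN.
have [_ _ minB] := sigma_minpP B B0; have {}minB := minB ws.
set e := sqnorm (u0 - us); set r := sqnorm (B *m ws) in minB *.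
set g := sqnorm (B^T *m (B *m ws)) in minB *.
have e0 : 0 <= e := sqnorm_ge0 _; have g0 : 0 <= g := sqnorm_ge0 _.
have r0 : 0 <= r := sqnorm_ge0 _; have k1 := kappaB_ge1.
have muN0 := lt0r_neq0 mu0; have LN0 := lt0r_neq0 L0; have tN0 := lt0r_neq0 tau_gt0.
have mE : mu = 4 * tau ^+ 2 * L by rewrite tau_sqr; field.
have etaE' : eta = tau / mu by rewrite -etamu mulfK.
have T1 : eta * ((eta^-1 + mu) * e) = (1 + tau) * e.
  by rewrite -etamu; field; rewrite gt_eqF.
have T2 : eta * ((2 - tau) / tau * bregman G u0 us) <= L / mu * e.
  have -> : eta * ((2 - tau) / tau * bregman G u0 us) =
    mu^-1 * ((2 - tau) * bregman G u0 us) by rewrite etaE'; field; rewrite ?tN0 ?muN0.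
  have -> : L / mu * e = mu^-1 * (L * e) by rewrite mulrAC mulrC.
  rewrite ler_wpM2l ?invr_ge0 ?(ltW mu0) //.
  have := D_le u0 us; have := D_ge0 u0 us; rewrite -/e => b0 bL.
  apply: le_trans (_ : 2 * bregman G u0 us <= _); last by lra.
  by rewrite ler_wpM2r //; have := tau_gt0; lra.
have LmuN0 : 0 < (mu * L)^-1 by rewrite invr_gt0 mulr_gt0.
have T3 : eta * (theta^-1 * r) <= kappaB B / (mu * L) / 4 * g.
  have -> : eta * (theta^-1 * r) = kappaB B / (mu * L) / 4 * (sigma_minp B ^+ 2 * r).
    by rewrite thetaE invrK /kappaB etaE mE; field; rewrite !gt_eqF.
  by apply: ler_wpM2l minB; apply/ltW; rewrite !divr_gt0 // mulr_gt0.
have T4 : eta * ((24 * L)^-1 * sigma_minp B ^+ 2 * r) <= kappaB B / (mu * L) / 4 * g.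
  have -> : eta * ((24 * L)^-1 * sigma_minp B ^+ 2 * r) =
    tau / 24 * ((mu * L)^-1 * (sigma_minp B ^+ 2 * r)).
    by rewrite etaE'; field; rewrite ?LN0 ?muN0.
  have -> : kappaB B / (mu * L) / 4 * g = kappaB B / 4 * ((mu * L)^-1 * g) by ring.
  apply: ler_pM.
  - by apply: divr_ge0 => //; exact: ltW.
  - by rewrite mulr_ge0 ?(ltW LmuN0) // mulr_ge0 ?sqr_ge0.
  - by have := tau_le; lra.
  - by rewrite ler_pM2l.
have T5 : 0 <= eta * (eta / (1 + eta * mu) * g).
  by rewrite mulr_ge0 ?(ltW eta_gt0) // mulr_ge0.
have Lm1 : 1 <= L / mu by rewrite ler_pdivlMr // mul1r.
have T6 : (1 + tau) * e <= 2 * (L / mu) * e.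
  by rewrite ler_wpM2r //; have := tau_le; lra.
have T7 : 0 <= kappaB B / (mu * L) * g.
  by apply: mulr_ge0 => //; apply/ltW; rewrite divr_gt0 // mulr_gt0.
move: T2 T3 T4 T5 T6 T7; set K := kappaB B / (mu * L); set M := L / mu.
move: (bregman G u0 us) => D0; rewrite !mulrDr mulrN T1.
lra.
Qed.

Lemma apapc_rate N (u0 : 'cV[R]_d) :
  (1 + rho) ^+ N * sqnorm (apapc G B b eta theta mu tau N u0 - us) <=
  3 * (L / mu) * sqnorm (u0 - us) + kappaB B / (mu * L) * sqnorm (grad G us).
Proof.
apply: le_trans (lyapunov_init u0).
have [u' [uf' [v' [E H]]]] := apapc_lyapunov N u0.
rewrite /apapc E /= -ler_pdivrMl // mulrCA.
apply: le_trans H; rewrite ler_wpM2l ?lyapunov_ge // exprn_ge0 //.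
by have := rho_gt0; lra.
Qed.

End Rate.

(** * Iteration counts *)

Section Complexity.
Context {R : realType}.
Implicit Types (s d : nat).

(** Moving from [us] along the kernel of [B] stays feasible, so smoothness forces the gradient to be
    orthogonal to that kernel. The range lemma is applied to [B^T *m B], which has the same kernel,
    in order to put the multiplier in the range of [B]. *)
Lemma solution_kkt {s d} (B : 'M[R]_(s, d)) b G (L : R) us :
  L_smooth G L -> is_solution G B b us ->
  exists ws, grad G us + B^T *m (B *m ws) = 0.
Proof.
move=> [_ smooth] [Bus opt].
have [v Bv0|w gw] := @orthogonal_kernel_range R _ _ (B^T *m B) (grad G us).
  have Bv : B *m v = 0 by apply/eqP; rewrite -sqnorm_eq0 sqnorm_tr Bv0 dot0v.
  apply: (@linear_coef_eq0 R _ (L / 2 * sqnorm v)) => t.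
  have := smooth us (us + t *: v); have := opt (us + t *: v).
  have -> : us + t *: v - us = t *: v by rewrite addrC addKr.
  rewrite mulmxDr -scalemxAr Bv scaler0 addr0 sqnormZ dotvZr => /(_ Bus).
  lra.
exists (- w); rewrite !mulmxN gw trmx_mul trmxK mulmxA; exact: subrr.
Qed.

(** From [1 - x / 2 <= expR (- (x / 2))] and [1 <= (1 + x) * (1 - x / 2)] on the unit interval. *)
Lemma expR_half_le (x : R) : 0 <= x <= 1 -> expR (x / 2) <= 1 + x.
Proof.
move=> /andP[x0 x1].
have := expR_ge1Dx (- (x / 2)); rewrite expRN => H.
have e0 := expR_gt0 (x / 2).
have : (1 - x / 2) * expR (x / 2) <= 1 by rewrite -ler_pdivlMr // mul1r.
nra.
Qed.

Lemma geometric_iterations (rho X dl : R) :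
  0 < rho <= 1 -> 0 < X -> 0 < dl -> exists N : nat,
  N%:R <= 2 / rho * Num.max 0 (ln (X / dl)) + 1 /\ X <= (1 + rho) ^+ N * dl.
Proof.
move=> /andP[r0 r1] X0 d0.
set y := 2 / rho * Num.max 0 (ln (X / dl)).
have m0 : 0 <= Num.max 0 (ln (X / dl)) by rewrite le_max lexx.
have y0 : 0 <= y by rewrite mulr_ge0 // divr_ge0 // ltW.
(* The successor of the integer part is at least [y], hence enough iterations, and at most
   [y + 1]. *)
exists (Num.truncn y).+1.
have /andP[t1 t2] := truncn_itv y0.
split; first by rewrite -natr1 lerD2r.
rewrite -ler_pdivrMr // -[leLHS]lnK ?posrE ?divr_gt0 //.
apply: le_trans (_ : expR (rho / 2) ^+ (Num.truncn y).+1 <= _); last first.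
  apply: lerXn2r; rewrite ?nnegrE ?expR_ge0 //; first by lra.
  by apply: expR_half_le; rewrite r1 (ltW r0).
rewrite -expRM_natr ler_expR.
apply: le_trans (_ : rho / 2 * y <= _); last first.
  by rewrite ler_wpM2l // ?divr_ge0 // ltW.
have -> : rho / 2 * y = Num.max 0 (ln (X / dl)).
  by rewrite /y; field; rewrite gt_eqF.
by rewrite le_max lexx orbT.
Qed.

Lemma apapc_complexity {s d} (B : 'M[R]_(s, d)) b G (L mu : R)
    us (u0 : 'cV[R]_d) (X dl : R) :
  B != 0 -> 0 < mu -> mu <= L -> L_smooth G L -> strongly_convex G mu ->
  is_solution G B b us -> 0 < dl -> 0 < X ->
  3 * (L / mu) * sqnorm (u0 - us) + kappaB B / (mu * L) * sqnorm (grad G us) <= X ->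
  exists (eta theta alpha tau : R) (N : nat),
    [/\ 0 < eta, 0 < theta, 0 < alpha & 0 < tau < 1] /\
    N%:R <= 25 * kappaB B * Num.sqrt (L / mu) * (1 + Num.max 0 (ln (X / dl))) /\
    sqnorm (apapc G B b eta theta alpha tau N u0 - us) <= dl.
Proof.
move=> B0 mu0 muL smooth conv sol d0 X0 HX.
have L0 : 0 < L := lt_le_trans mu0 muL.
have [ws kkt] := solution_kkt B b G L us smooth sol.
have [smin0 sminmax _] := sigma_minpP B B0.
have smax0 : 0 < sigma_max B := lt_le_trans smin0 sminmax.
have k1 := kappaB_ge1 B B0.
have k0 : 0 < kappaB B := lt_le_trans ltr01 k1.
have [S SE] : exists x : R, x = Num.sqrt (L / mu) by eexists.
have S1 : 1 <= S by rewrite SE -[leLHS]sqrtr1 ler_wsqrtr // ler_pdivlMr // mul1r.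
have S0 : 0 < S := lt_le_trans ltr01 S1.
have S2 : S ^+ 2 = L / mu by rewrite SE sqr_sqrtr // divr_ge0 // ltW.
have [tau tauE] : exists x : R, x = (2 * S)^-1 by eexists.
have tau0 : 0 < tau by rewrite tauE invr_gt0 mulr_gt0.
have tau1 : tau <= 2^-1 by rewrite tauE lef_pV2 ?posrE ?mulr_gt0 //; lra.
have tau2 : tau ^+ 2 = mu / (4 * L).
  by rewrite tauE exprVn exprMn S2; field; rewrite !gt_eqF.
have [eta etaE] : exists x : R, x = (4 * tau * L)^-1 by eexists.
have eta0 : 0 < eta by rewrite etaE invr_gt0 !mulr_gt0.
have [theta thetaE] : exists x : R, x = (eta * sigma_max B ^+ 2)^-1 by eexists.
have [rho rhoE] : exists x : R, x = tau / (6 * kappaB B) by eexists.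
have k6 : 0 < 6 * kappaB B by apply: mulr_gt0.
have rho0 : 0 < rho by rewrite rhoE divr_gt0.
have rho1 : rho <= 1 by rewrite rhoE ler_pdivrMr //; lra.
have [|N [NX XN]] := geometric_iterations rho X dl _ X0 d0; first by rewrite rho0.
exists eta, theta, mu, tau, N; split; first split => //.
- by rewrite thetaE invr_gt0 mulr_gt0 // exprn_gt0.
- by rewrite tau0; lra.
split; last first.
  have := apapc_rate B b G L mu us ws B0 L0 mu0 muL smooth conv sol.1 kkt
    tau eta theta rho tau0 tau2 etaE thetaE rhoE N u0.
  move=> /le_trans /(_ HX) /le_trans /(_ XN).
  by rewrite ler_pM2l // exprn_gt0 //; lra.
apply: le_trans NX _.
(* The constant 25 is this 24 plus one: the rounding term 1 is absorbed because [kappaB B * S] is at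
   least 1. *)
have -> : 2 / rho = 24 * (kappaB B * S).
  by rewrite rhoE tauE; field; rewrite !gt_eqF.
have kS : 1 <= kappaB B * S by rewrite -[leLHS]mulr1; apply: ler_pM.
have m0 : 0 <= Num.max 0 (ln (X / dl)) by rewrite le_max lexx.
rewrite -SE; set K := kappaB B * S in kS *.
have -> : 25 * kappaB B * S = 25 * K by rewrite /K mulrA.
by move: (Num.max _ _) m0 K kS => M M0 K K1; nra.
Qed.

End Complexity.

(** * The regularised problem *)

Section Regularization.
Local Open Scope classical_set_scope.
Context {R : realType} {d : nat}.
Implicit Types u v : 'cV[R]_d.

Definition sqdist (u0 u : 'cV[R]_d) : R := sqnorm (u0 - u).

(** The exact second-order expansion gives the derivative of the penalty and shows that it adds
    exactly [nu] to both the smoothness and the strong convexity constants. *)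
Lemma sqdist_shift u0 u (h : 'cV[R]_d) :
  sqdist u0 (h + u) = sqdist u0 u + 2 * dotv (u - u0) h + sqnorm h.
Proof.
rewrite /sqdist.
have -> : u0 - (h + u) = - (u - u0) - h by rewrite opprB opprD addrA addrAC.
rewrite -(opprB u u0); move: (u - u0) => w.
by rewrite sqnormB !sqnormN dotvNl; ring.
Qed.

Lemma differentiable_sqdist u0 u : differentiable (sqdist u0) u.
Proof.
have -> : sqdist u0 = \sum_(i < d) (fun u => (u0 i 0 - u i 0) * (u0 i 0 - u i 0)).
  apply/funext => x; rewrite fct_sumE; apply: eq_bigr => i _; by rewrite !mxE.
apply: differentiable_sum => i.
have h : differentiable ((cst (u0 i 0) : 'cV[R]_d -> R) -
    (fun x : 'cV[R]_d => x i 0 : R)) u.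
  by apply: differentiableB => //; exact: differentiable_coord.
exact: differentiableM.
Qed.

Lemma derive_sqdist u0 u v : 'D_v (sqdist u0) u = 2 * dotv (u - u0) v.
Proof.
apply/cvg_lim => //.
(* For nonzero [t] the difference quotient equals this affine function of [t]. *)
have H : (2 * dotv (u - u0) v + t * sqnorm v @[t --> (0:R)^']) --> 2 * dotv (u - u0) v.
  rewrite -[X in _ --> X]addr0 -{2}(mul0r (sqnorm v)).
  apply: cvgD; first exact: cvg_cst.
  apply: cvgM; last exact: cvg_cst.
  exact: nbhs_dnbhs.
apply: cvg_trans H; apply: near_eq_cvg.
near=> t => /=.
have t0 : t != 0 by near: t; exact: nbhs_dnbhs_neq.
rewrite sqdist_shift sqnormZ dotvZr /GRing.scale /=; field.
Unshelve. all: by end_near.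
Qed.

Lemma grad_regG (G : 'cV[R]_d -> R) nu u0 u : differentiable G u ->
  grad (regG G nu u0) u = grad G u + nu *: (u - u0).
Proof.
move=> dG.
have -> : regG G nu u0 = G + (nu / 2) \*: sqdist u0 by [].
apply/matrixP => i j; rewrite !mxE ord1.
rewrite diffD //; last by apply: differentiableZ; exact: differentiable_sqdist.
rewrite diffZ; last exact: differentiable_sqdist.
rewrite /= -(deriveE _ (differentiable_sqdist _ _)) derive_sqdist.
have -> : dotv (u - u0) (delta_mx i 0) = u i 0 - u0 i 0.
  rewrite /dotv (bigD1 i) //= big1 => [|k ki]; first by rewrite !mxE !eqxx mulr1 addr0.
  by rewrite [delta_mx _ _ _ _]mxE (negbTE ki) mulr0.
by rewrite /GRing.scale /=; field.
Qed.

Lemma differentiable_regG (G : 'cV[R]_d -> R) nu u0 u : differentiable G u ->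
  differentiable (regG G nu u0) u.
Proof.
move=> dG; apply: (@differentiableD _ _ _ G) => //.
by apply: (@differentiableZ _ _ _ (sqdist u0)); exact: differentiable_sqdist.
Qed.

Let dotv_regG nu (g w h : 'cV[R]_d) :
  dotv (g + nu *: w) h = dotv g h + nu * dotv w h.
Proof. by rewrite dotvDl dotvZl. Qed.

Lemma L_smooth_regG (G : 'cV[R]_d -> R) L nu u0 :
  L_smooth G L -> L_smooth (regG G nu u0) (L + nu).
Proof.
move=> [dG smooth]; split=> [u|u u']; first exact: differentiable_regG.
rewrite grad_regG //; have := smooth u u'; rewrite /regG -!/(sqdist u0 _).
have -> : sqdist u0 u' = sqdist u0 ((u' - u) + u) by rewrite subrK.
rewrite sqdist_shift dotv_regG; lra.
Qed.

Lemma strongly_convex_regG (G : 'cV[R]_d -> R) nu u0 :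
  (forall u, differentiable G u) -> strongly_convex G 0 ->
  strongly_convex (regG G nu u0) nu.
Proof.
move=> dG conv u u'.
rewrite grad_regG //; have := conv u u'; rewrite /regG -!/(sqdist u0 _).
have -> : sqdist u0 u' = sqdist u0 ((u' - u) + u) by rewrite subrK.
rewrite sqdist_shift dotv_regG; lra.
Qed.

(** The minimum is taken over the feasible points with [sqdist u0 u <= r], a compact set containing
    [us]. Any feasible point outside has a larger penalty than [us] and no smaller [G], so the
    minimum is global. *)
Lemma regG_solution {s} (B : 'M[R]_(s, d)) b (G : 'cV[R]_d -> R) nu r us u0 :
  (forall u, differentiable G u) -> 0 < nu -> is_solution G B b us ->
  sqnorm (u0 - us) <= r ->
  exists2 ur, is_solution (regG G nu u0) B b ur &
    sqnorm (u0 - ur) <= r /\ G ur <= G us + nu / 2 * r.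
Proof.
move=> dG nu0 [Bus opt] r0.
pose A := [set u : 'cV[R]_d | B *m u = b] `&` sqdist u0 @^-1` [set t | t <= r].
have Ac : closed A.
  apply: closedI; first exact: closed_mulmx_eq.
  apply: preimage_closed; last exact: closed_le.
  by move=> u _; apply/differentiable_continuous/differentiable_sqdist.
have rc : continuous (regG G nu u0).
  by move=> u; apply/differentiable_continuous/differentiable_regG.
have [||ur [Bur ur_r] urmin] := @min_closed_bounded R d _ A (2 * sqnorm u0 + 2 * r) rc Ac.
- move=> u [_ /= ur]; have := sqnormD_le2 u0 (u - u0).
  rewrite addrC subrK -(opprB u0 u) sqnormN; rewrite /sqdist in ur; lra.
- by exists us; split.
rewrite /= in Bur ur_r.
have us_min : regG G nu u0 ur <= regG G nu u0 us by apply: urmin.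
exists ur; last split=> //.
  split=> // u Bu; have [ur'|] := leP (sqdist u0 u) r; first exact: urmin.
  rewrite /sqdist => lt_r; apply: le_trans us_min _; rewrite /regG.
  apply: lerD; first exact: opt.
  by rewrite ler_pM2l ?divr_gt0 //; lra.
move: us_min; rewrite /regG => H.
have h1 : nu / 2 * sqnorm (u0 - us) <= nu / 2 * r by rewrite ler_pM2l ?divr_gt0.
have h2 : 0 <= nu / 2 * sqnorm (u0 - ur).
  by rewrite mulr_ge0 ?sqnorm_ge0 // divr_ge0 // ltW.
lra.
Qed.

End Regularization.

(** * Complexity of the convex case *)

Section ConvexCase.
Context {R : realType}.

Lemma max0_ge0 (x : R) : 0 <= Num.max 0 x.
Proof. by rewrite le_max lexx. Qed.

Lemma grad_bound_near {d} (G : 'cV[R]_d -> R) (L r : R) us v :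
  L_smooth G L -> strongly_convex G 0 -> 0 < L -> sqnorm (v - us) <= r ->
  sqnorm (grad G v) <= 2 * (sqnorm (grad G us) + L ^+ 2 * r).
Proof.
move=> smooth conv L0 vr; rewrite mulrDr.
apply: le_trans (sqnorm_le2B (grad G us) _) _; rewrite lerD2l ler_pM2l //.
apply: le_trans (grad_lipschitz G L 0 L0 (lexx 0) smooth conv v us) _.
by rewrite ler_wpM2l ?sqr_ge0.
Qed.

(** [K / eps] bounds the initial error and [c * eps ^+ 2] is the target for [|uN - ur|^2], whence
    [eps ^+ 3] in the logarithm; the cap [C1] on [eps] keeps [K] and [c] independent of it. *)
Lemma regularized_complexity {s d} (B : 'M[R]_(s, d)) b G (L r eps C1 M : R) us u0 :
  B != 0 -> L_smooth G L -> strongly_convex G 0 -> 0 < L ->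
  is_solution G B b us -> 0 < r -> sqnorm (u0 - us) <= r -> 0 < eps ->
  eps <= C1 -> (forall v, sqnorm (v - us) <= 4 * r -> sqnorm (grad G v) <= M) ->
  let K := 3 * (C1 + L * r) * r + kappaB B * r / L * (2 * M + 2 * C1 ^+ 2 / r) in
  let c := (4 * (M + 1 + L * C1))^-1 in
  exists (eta theta alpha tau : R) (N : nat),
    let uN := apapc (regG G (eps / r) u0) B b eta theta alpha tau N u0 in
    [/\ 0 < eta, 0 < theta, 0 < alpha & 0 < tau < 1] /\
    N%:R <= 25 * kappaB B * Num.sqrt (1 + L * r / eps)
      * (1 + Num.max 0 (ln (K / c / eps ^+ 3))) /\
    G uN - G us <= eps /\ sqnorm (B *m uN - b) <= sigma_max B ^+ 2 * eps ^+ 2.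
Proof.
move=> B0 smooth conv L0 sol r0 Hr e0 eC1 HM K c.
have KE : K = 3 * (C1 + L * r) * r + kappaB B * r / L * (2 * M + 2 * C1 ^+ 2 / r) := erefl.
have cE : c = (4 * (M + 1 + L * C1))^-1 := erefl.
clearbody c K.
have nu0 : 0 < eps / r by rewrite divr_gt0.
have [ur solr [ur_r Gur]] := regG_solution B b G _ r us u0 smooth.1 nu0 sol Hr.
have k1 := kappaB_ge1 B B0.
have k0 : 0 < kappaB B := lt_le_trans ltr01 k1.
have C10 : 0 < C1 := lt_le_trans e0 eC1.
have M0 : 0 <= M.
  apply: le_trans (sqnorm_ge0 (grad G us)) (HM us _).
  by rewrite subrr sqnorm0 mulr_ge0 // ltW.
(* Both [ur] and [us] are within squared distance [r] of [u0], hence within [4 * r] of each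
   other. *)
have gM : sqnorm (grad G ur) <= M.
  apply: HM; have := sqnormD_le2 (ur - u0) (u0 - us).
  by rewrite addrA subrK -(opprB u0 ur) sqnormN; lra.
have c_gt0 : 0 < c.
  by rewrite cE invr_gt0 mulr_gt0 //; have := mulr_gt0 L0 C10; lra.
have cM : c * (M + 1) + L / 2 * c * C1 <= 4^-1.
  have cM : c * (M + 1 + L * C1) = 4^-1.
    rewrite cE; field; rewrite gt_eqF //; have := mulr_gt0 L0 C10; lra.
  by have := mulr_gt0 c_gt0 (mulr_gt0 L0 C10); lra.
have c1 : c <= 1.
  have := mulr_ge0 (ltW c_gt0) M0; have := mulr_gt0 c_gt0 (mulr_gt0 L0 C10); lra.
have t0 : 0 <= 2 * M + 2 * C1 ^+ 2 / r.
  apply: addr_ge0; first exact: mulr_ge0.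
  by apply: divr_ge0; [apply: mulr_ge0 => //; exact: sqr_ge0 | exact: ltW].
have K0 : 0 < K.
  rewrite KE; apply: ltr_wpDr; last by rewrite !mulr_gt0 // addr_gt0 // mulr_gt0.
  by apply: mulr_ge0 t0; apply: divr_ge0; [apply: mulr_ge0|]; exact: ltW.
have [||||eta [theta [alpha [tau [N [pos [HN acc]]]]]]] :=
  apapc_complexity B b (regG G (eps / r) u0) (L + eps / r) (eps / r) ur u0
    (K / eps) (c * eps ^+ 2) B0 nu0 _ (L_smooth_regG G L _ u0 smooth)
    (strongly_convex_regG G _ u0 smooth.1 conv) solr.
- by rewrite lerDr ltW.
- by rewrite mulr_gt0 ?exprn_gt0.
- by rewrite divr_gt0.
(* Each of the two initial terms is bounded by a constant over [eps], the remaining occurrences of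
   [eps] being replaced by [C1] or dropped from a denominator. *)
- rewrite grad_regG; last exact: smooth.1.
  have h1 : (L + eps / r) / (eps / r) * sqnorm (u0 - ur) <= (C1 + L * r) / eps * r.
    have -> : (L + eps / r) / (eps / r) = (eps + L * r) / eps by field; rewrite !gt_eqF.
    apply: ler_pM; rewrite ?sqnorm_ge0 //.
      by apply: divr_ge0; [apply: addr_ge0; [|apply: mulr_ge0]|]; exact: ltW.
    by rewrite ler_wpM2r ?invr_ge0 ?(ltW e0) // lerD2r.
  have h2 : sqnorm (grad G ur + (eps / r) *: (ur - u0)) <= 2 * M + 2 * C1 ^+ 2 / r.
    apply: le_trans (sqnormD_le2 _ _) _; rewrite sqnormZ -(opprB u0 ur) sqnormN.
    have h : (eps / r) ^+ 2 * sqnorm (u0 - ur) <= C1 ^+ 2 / r.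
      apply: le_trans (ler_wpM2l (sqr_ge0 _) ur_r) _.
      have -> : (eps / r) ^+ 2 * r = eps ^+ 2 / r by field; rewrite gt_eqF.
      rewrite ler_wpM2r ?invr_ge0 ?(ltW r0) // ler_sqr // nnegrE; exact: ltW.
    lra.
  have h3 : kappaB B / (eps / r * (L + eps / r)) <= kappaB B * r / L / eps.
    have -> : kappaB B * r / L / eps = kappaB B / (eps / r * L) by field; rewrite !gt_eqF.
    apply: ler_wpM2l; first exact: ltW.
    have nuL : 0 < eps / r * L by apply: mulr_gt0.
    have nuLn : 0 < eps / r * (L + eps / r) by apply: mulr_gt0 => //; apply: addr_gt0.
    by rewrite lef_pV2 // ler_pM2l // lerDl ltW.
  have h4 := ler_pM _ (sqnorm_ge0 _) h3 h2.
  have -> : K / eps = 3 * ((C1 + L * r) / eps * r) +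
      kappaB B * r / L / eps * (2 * M + 2 * C1 ^+ 2 / r).
    by rewrite KE; field; rewrite !gt_eqF.
  rewrite -mulrA; apply: lerD; first by rewrite ler_pM2l.
  by apply: h4; apply: divr_ge0; [|apply: mulr_ge0; [|apply: addr_ge0]]; exact: ltW.
exists eta, theta, alpha, tau, N => uN; split => //.
rewrite -/uN in acc.
split; [|split].
- apply: le_trans HN _.
  have -> : (L + eps / r) / (eps / r) = 1 + L * r / eps by field; rewrite !gt_eqF.
  have -> : K / eps / (c * eps ^+ 2) = K / c / eps ^+ 3 by field; rewrite !gt_eqF.
  exact: lexx.
(* Half of [eps] is spent on [G ur - G us]. The other half covers [G uN - G ur]: Young's inequality
   leaves [eps / 4] for the gradient norm, and [cM] bounds the rest by [eps / 4]. Using [M + 1]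
   keeps the weight finite when [M = 0]. *)
- have h1 := bregman_le G L smooth uN ur; rewrite /bregman in h1.
  have M1 : 0 < M + 1 by lra.
  have s0 : 0 < eps / (2 * (M + 1)) by rewrite divr_gt0 // mulr_gt0.
  have h2 := young_dotv (grad G ur) (uN - ur) _ s0.
  have h3 : eps / (2 * (M + 1)) * sqnorm (grad G ur) <= eps / 2.
    have -> : eps / 2 = eps / (2 * (M + 1)) * (M + 1) by field; rewrite gt_eqF.
    by rewrite ler_pM2l //; lra.
  have h4 : (eps / (2 * (M + 1)))^-1 * sqnorm (uN - ur) <= 2 * (c * (M + 1)) * eps.
    have -> : 2 * (c * (M + 1)) * eps = (eps / (2 * (M + 1)))^-1 * (c * eps ^+ 2).
      by field; rewrite !gt_eqF.
    by rewrite ler_pM2l // invr_gt0.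
  have h5 : L / 2 * sqnorm (uN - ur) <= L / 2 * c * C1 * eps.
    have -> : L / 2 * c * C1 * eps = L / 2 * (c * (C1 * eps)) by ring.
    rewrite ler_pM2l ?divr_gt0 //; apply: le_trans acc _.
    by rewrite ler_pM2l // expr2 ler_pM2r.
  have h6 : (c * (M + 1) + L / 2 * c * C1) * eps <= 4^-1 * eps by rewrite ler_pM2r.
  have h7 : eps / r / 2 * r = eps / 2 by field; rewrite gt_eqF.
  rewrite h7 in Gur.
  move: h1 h2 h3 h4 h5 h6 Gur; clear.
  move: (dotv _ _) (sqnorm (uN - ur)) => dt sq.
  move: (_ * sqnorm _) (_ * sq) (_ * sq) => x y z.
  lra.
- rewrite -solr.1 -mulmxBr; apply: le_trans (sqnorm_le_sigma_max B _ B0) _.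
  apply: ler_wpM2l; first exact: sqr_ge0.
  by apply: le_trans acc _; rewrite ger_pMl // exprn_gt0.
Qed.

End ConvexCase.

(* The threshold C0 is C expR T, where T compensates for e0 / eps being small when
e0 < eps <= C1. *)
Lemma log_absorb {R : realType} (e0 C1 K : R) : 0 < e0 -> 0 < C1 -> 0 < K ->
  exists C0, 0 < C0 /\ forall eps, 0 < eps <= C1 ->
  Num.sqrt (1 + e0 / eps) * (1 + Num.max 0 (ln (K / eps ^+ 3))) <=
  6 * Num.sqrt (e0 / eps) * (1 + Num.max 0 (ln (C0 / eps))).
Proof.
move=> e00 C10 K0.
have [C CE] : exists C, C = K + 1 + C1 + e0 by eexists.
have [CK CC1 Ce0 C_ge1] : [/\ K <= C, C1 <= C, e0 <= C & 1 <= C] by split; lra.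
have C0 : 0 < C by lra.
have s0 : 0 < Num.sqrt (e0 / C1) by rewrite sqrtr_gt0 divr_gt0.
have lC0 : 0 <= ln C by rewrite ln_ge0.
have le0 : ln e0 <= ln C by rewrite ler_ln ?posrE.
have lK : ln K <= ln C by rewrite ler_ln ?posrE.
have [T TE] : exists T, T = (1 + (ln C - ln e0)) / Num.sqrt (e0 / C1) by eexists.
have T0 : 0 <= T by rewrite TE divr_ge0 ?(ltW s0) //; lra.
exists (C * expR T); split; first by rewrite mulr_gt0 ?expR_gt0.
move=> eps /andP[ep0 epC1].
have leps : ln eps <= ln C by rewrite ler_ln ?posrE //; lra.
(* The cube costs a factor 3; the case split in [main] costs another 2, which gives the 6. *)
have m'E : Num.max 0 (ln (K / eps ^+ 3)) <= 3 * (ln C - ln eps).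
  rewrite ge_max ln_div ?posrE ?exprn_gt0 // lnXn // -mulr_natr.
  by apply/andP; split; lra.
have mE : ln (C * expR T / eps) = ln C - ln eps + T.
  by rewrite ln_div ?posrE ?mulr_gt0 ?expR_gt0 // lnM ?posrE ?expR_gt0 // expRK addrAC.
have m0 : ln (C * expR T / eps) <= Num.max 0 (ln (C * expR T / eps)).
  by rewrite le_max lexx orbT.
rewrite mE in m0 *.
have [q qE] : exists q, q = Num.sqrt (e0 / eps) by eexists.
have q0 : 0 <= q by rewrite qE sqrtr_ge0.
have sq : Num.sqrt (1 + e0 / eps) <= 1 + q.
  rewrite -[leRHS]ger0_norm; last by lra.
  rewrite -sqrtr_sqr ler_wsqrtr //.
  have -> : e0 / eps = q ^+ 2 by rewrite qE sqr_sqrtr // divr_ge0 // ltW.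
  by rewrite !expr2; nra.
rewrite -qE; move: m0; set m := ln C - ln eps in m'E leps *.
move: (Num.max 0 _) => x m0.
have mm0 : 0 <= m by rewrite /m; lra.
(* If [q >= 1] then [1 + q <= 2 * q]. Otherwise [e0 <= eps], so [1 + m] is at most
   [1 + ln C - ln e0], which is [Num.sqrt (e0 / C1) * T] by the choice of [T], and [q] is at least
   that square root. *)
have main : (1 + q) * (1 + m) <= 2 * q * (1 + m + T).
  have [q1|q1] := leP 1 q.
    apply: ler_pM; lra.
  have e0eps : e0 <= eps.
    rewrite leNgt; apply/negP => lt_eps; move: q1; rewrite qE ltNge => /negP; apply.
    by rewrite -[leLHS]sqrtr1 ler_wsqrtr // ler_pdivlMr // mul1r ltW.
  have qT : 1 + m <= q * T.
    apply: le_trans (_ : Num.sqrt (e0 / C1) * T <= _); last first.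
      rewrite ler_wpM2r // qE ler_wsqrtr // ler_pM2l // lef_pV2 ?posrE //.
    rewrite TE mulrC divfK ?gt_eqF // lerD2l /m lerD2l lerN2 ler_ln ?posrE //.
  nra.
apply: le_trans (_ : (1 + q) * (3 * (1 + m)) <= _).
  by apply: ler_pM; rewrite ?sqrtr_ge0 ?addr_ge0 ?max0_ge0 //; lra.
have : 6 * q * (1 + m + T) <= 6 * q * (1 + x) by rewrite ler_wpM2l ?mulr_ge0 //; lra.
lra.
Qed.

Theorem theorem2p4 (R : realType) :
  (* Part 1: strongly convex case *)
  (exists C : R, 0 < C /\
   forall (s d : nat) (B : 'M[R]_(s, d)) (b : 'cV[R]_s) (G : 'cV[R]_d -> R)
     (L mu : R) (ustar u0 : 'cV[R]_d) (Rad : R),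
     B != 0 -> (exists v : 'cV[R]_d, B *m v = b) ->
     convex_fun G -> L_smooth G L -> strongly_convex G mu ->
     0 < mu -> mu < L ->
     is_solution G B b ustar -> sqnorm (u0 - ustar) <= Rad ^+ 2 ->
     exists C0 : R, 0 < C0 /\
     forall eps : R, 0 < eps ->
     exists (eta theta alpha tau : R) (N : nat),
       [/\ 0 < eta, 0 < theta, 0 < alpha & 0 < tau < 1] /\
       N%:R <= C * kappaB B * Num.sqrt (L / mu)
                 * (1 + Num.max 0 (ln (C0 / eps))) /\
       sqnorm (apapc G B b eta theta alpha tau N u0 - ustar) <= eps)
  /\
  (* Part 2: convex case, via the regularization G^nu, nu = eps / Rad^2 *)
  (exists C : R, 0 < C /\
   forall (s d : nat) (B : 'M[R]_(s, d)) (b : 'cV[R]_s) (G : 'cV[R]_d -> R)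
     (L : R) (ustar u0 : 'cV[R]_d) (Rad : R),
     B != 0 -> (exists v : 'cV[R]_d, B *m v = b) ->
     convex_fun G -> L_smooth G L -> strongly_convex G 0 ->
     0 < L ->
     is_solution G B b ustar -> 0 < Rad -> sqnorm (u0 - ustar) <= Rad ^+ 2 ->
     exists C0 : R, 0 < C0 /\
     forall eps : R, 0 < eps ->
     exists (eta theta alpha tau : R) (N : nat),
       let uN := apapc (regG G (eps / Rad ^+ 2) u0) B b eta theta alpha tau N u0 in
       [/\ 0 < eta, 0 < theta, 0 < alpha & 0 < tau < 1] /\
       N%:R <= C * kappaB B * Num.sqrt (L * Rad ^+ 2 / eps)
                 * (1 + Num.max 0 (ln (C0 / eps))) /\
       G uN - G ustar <= eps /\
       sqnorm (B *m uN - b) <= C * sigma_max B ^+ 2 * eps ^+ 2).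
Proof.
split.
  exists 25; split=> // s d B b G L mu us u0 Rad B0 _ _ smooth conv mu0 muL sol _.
  (* The absolute value plus one makes the bound on the initial error positive, so that it can stand
     inside the logarithm. *)
  exists (`|3 * (L / mu) * sqnorm (u0 - us) +
    kappaB B / (mu * L) * sqnorm (grad G us)| + 1).
  have X0 : 0 < `|3 * (L / mu) * sqnorm (u0 - us) +
    kappaB B / (mu * L) * sqnorm (grad G us)| + 1 by rewrite ltr_wpDl.
  split=> // eps e0.
  apply: apapc_complexity => //; first exact: ltW.
  by apply: ler_wpDr => //; exact: ler_norm.
(* The constant is 25 from [apapc_complexity] times 6 from [log_absorb]. *)
exists 150; split=> // s d B b G L us u0 Rad B0 _ _ smooth conv L0 sol Rad0 Hr.
have r0 : 0 < Rad ^+ 2 by rewrite exprn_gt0.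
have k0 : 0 < kappaB B := lt_le_trans ltr01 (kappaB_ge1 B B0).
(* Above this threshold [u0] already meets both requirements: [eps] exceeds the objective gap, and
   [eps ^+ 2] exceeds [Rad ^+ 2]. *)
have [C1 C1E] : exists C1, C1 = Rad + `|G u0 - G us| + 1 by eexists.
have [C10 C1R C1G] : [/\ 0 < C1, Rad <= C1 & G u0 - G us <= C1].
  by have := ler_norm (G u0 - G us); have := normr_ge0 (G u0 - G us); split; lra.
have [M ME] : exists M, M = 2 * (sqnorm (grad G us) + L ^+ 2 * (4 * Rad ^+ 2)) by eexists.
have M0 : 0 <= M.
  rewrite ME mulr_ge0 // addr_ge0 ?sqnorm_ge0 // mulr_ge0 ?sqr_ge0 //.
  by rewrite mulr_ge0 // ltW.
have HM v : sqnorm (v - us) <= 4 * Rad ^+ 2 -> sqnorm (grad G v) <= M.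
  by rewrite ME; exact: grad_bound_near.
clear ME.
pose K := 3 * (C1 + L * Rad ^+ 2) * Rad ^+ 2 +
  kappaB B * Rad ^+ 2 / L * (2 * M + 2 * C1 ^+ 2 / Rad ^+ 2).
pose c := (4 * (M + 1 + L * C1))^-1.
have c0 : 0 < c.
  by rewrite invr_gt0 mulr_gt0 // addr_gt0 ?mulr_gt0 // ltr_wpDl.
have K0 : 0 < K.
  apply: ltr_wpDr; last by rewrite !mulr_gt0 // addr_gt0 // mulr_gt0.
  apply: mulr_ge0; first by apply: divr_ge0; [apply: mulr_ge0|]; exact: ltW.
  apply: addr_ge0; first exact: mulr_ge0.
  by apply: divr_ge0; [apply: mulr_ge0 => //; exact: sqr_ge0 | exact: ltW].
have [C0 [C00 HC0]] := log_absorb _ _ _ (mulr_gt0 L0 r0) C10 (divr_gt0 K0 c0).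
exists C0; split => // eps e0.
have [epsC1|C1eps] := leP eps C1.
  have [eta [theta [alpha [tau [N [pos [HN [HG HB]]]]]]]] :=
    regularized_complexity B b G L _ eps C1 M us u0 B0 smooth conv L0 sol r0 Hr e0 epsC1 HM.
  exists eta, theta, alpha, tau, N => uN; split=> //; split; last split=> //.
    apply: le_trans HN _.
    have := HC0 eps; rewrite e0 epsC1 => /(_ erefl) /(ler_wpM2l (ltW k0)).
    rewrite -/K -/c; lra.
  apply: le_trans HB _; rewrite -mulrA ler_peMl ?ler1n //.
  by rewrite mulr_ge0 ?sqr_ge0.
(* With zero iterations the output is [u0], so any admissible parameters serve. *)
exists 1, 1, 1, 2^-1, 0%N => uN; split; first by split=> //; apply/andP; split; lra.
split.
  rewrite mulr_ge0 ?addr_ge0 ?max0_ge0 // mulr_ge0 ?sqrtr_ge0 //.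
  by rewrite mulr_ge0 // ltW.
rewrite /uN /apapc /=; split; first by lra.
rewrite -sol.1 -mulmxBr; apply: le_trans (sqnorm_le_sigma_max B _ B0) _.
have -> : 150 * sigma_max B ^+ 2 * eps ^+ 2 = sigma_max B ^+ 2 * (150 * eps ^+ 2).
  by ring.
apply: ler_wpM2l; first exact: sqr_ge0.
apply: le_trans Hr _; apply: le_trans (_ : eps ^+ 2 <= _).
  by rewrite ler_sqr ?nnegrE ?(ltW Rad0) ?(ltW e0) //; lra.
by rewrite ler_peMl ?sqr_ge0 ?ler1n.
Qed.
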